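(* When the algorithm TS-CF is run on a $K$-armed Bernoulli corrupt bandit with strictly monotonic and continuous corruption functions $\{g_a\}_{a\in A}$, $A=\{1,\dots,K\}$, in which arm $1$ is the optimal arm, for all $\psi>0$ there exists a constant $C_\psi=C(\psi,\{\mu_a\}_{a\in A},\{g_a\}_{a\in A})$ such that at time $T$, $$\mathrm{Regret}_T \;\leq\; (1+\psi)\sum_{a = 2}^K\frac{\Delta_a\log(T)}{d(\lambda_a,g_a(\mu_1))} + C_\psi.$$
   Context: **Bernoulli corrupt bandit.** There is a set of arms $A=\{1,\dots,K\}$. Each arm $a$ has an unknown Bernoulli reward distribution with mean $\mu_a\in[0,1]$, an unknown Bernoulli feedback distribution with mean $\lambda_a\in[0,1]$, and a known corruption function $g_a$, continuous at least on $[0,1]$, such that $g_a(\mu_a)=\lambda_a$. The functions $g_a$ may differ from one arm to another, and each may be increasing or decreasing; $g_a^{-1}$ denotes the inverse function of the strictly monotonic function $g_a$. If the learner pulls arm $a$ at time $t$, they receive a reward $R_t$ drawn from the reward distribution of $a$ (not observed) and observe a feedback $F_t$ drawn from the feedback distribution of $a$. The arm $\hat a_t$ pulled at time $t$ is chosen based only on the previously observed feedback (and the algorithm's own sampling). **Regret.** Arm $1$ is the optimal arm, i.e. the arm of maximal mean reward $\mu_a$ (without loss of generality). Put $\Delta_a=\mu_1-\mu_a$ and let $N_a(T)=\sum_{t=1}^{T}\mathbf 1_{(\hat a_t=a)}$ be the number of pulls of arm $a$ up to time $T$. Then $\mathrm{Regret}_T=\mathbb E[\mu_1T-\sum_{t=1}^TR_t]=\sum_{a=2}^K\Delta_a\,\mathbb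 E[N_a(T)]$. **Divergence.** $d(x,y)=x\log(x/y)+(1-x)\log((1-x)/(1-y))$ is the Kullback–Leibler divergence between the Bernoulli distributions of means $x$ and $y$. **Algorithm TS-CF (Thompson sampling for corrupted feedback).** For each arm $a$, set $\mathrm{success}_a=0$ and $\mathrm{fail}_a=0$. For $t=0,\dots,T-1$: for each arm $a$, sample $\theta_a(t)$ from $\mathrm{Beta}(\mathrm{success}_a+1,\mathrm{fail}_a+1)$; pull arm $\hat a_{t+1}=\arg\max_a g_a^{-1}(\theta_a(t))$ and observe the feedback $F_{t+1}$; if $F_{t+1}=1$ increase $\mathrm{success}_{\hat a_{t+1}}$ by $1$, otherwise increase $\mathrm{fail}_{\hat a_{t+1}}$ by $1$.
   Formalization: For each arm a with Δ_a > 0 it is additionally assumed that 0 < g_a(μ_1) < 1, so that d(λ_a, g_a(μ_1)) is defined and finite; with the convention d = +∞ at g_a(μ_1) ∈ {0,1} the bound can fail. *)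

(* Defs.v *)
From HB Require Import structures.
From mathcomp Require Import all_boot all_order all_algebra.
From mathcomp Require Import all_classical all_reals all_analysis.

Set Implicit Arguments.
Unset Strict Implicit.
Unset Printing Implicit Defensive.

Import Order.TTheory GRing.Theory Num.Theory.
Import numFieldNormedType.Exports.
Local Open Scope classical_set_scope.
Local Open Scope ring_scope.

(* [0 * ln (0 / y)] is 0, as usual.  The divergence is finite for y in ]0, 1[;
   for y = 0 or y = 1 the totalized [/] and [ln] give values without meaning. *)
Definition kl_bernoulli (R : realType) (x y : R) : R :=
  x * ln (x / y) + (1 - x) * ln ((1 - x) / (1 - y)).

Definition strictly_monotonic01 (R : realType) (g : R -> R) : Prop :=
  {in `[0, 1]%R &, {homo g : x y / x < y}} \/
  {in `[0, 1]%R &, {homo g : x y /~ x < y}}.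

(* [ginv] is the inverse of [g] on the image of [0, 1].  A Beta sample may fall
   in ]0, 1[ but outside that image; there [ginv] may take any values that keep
   it monotone, for instance the inverse of [g] on a larger interval, or the
   nearest endpoint of [0, 1]. *)
Definition monotone_inverse01 (R : realType) (g ginv : R -> R) : Prop :=
  let D : set R := `]0, 1[ `|` g @` `[0, 1] in
  {in `[0, 1]%R, cancel g ginv} /\
  ({in D &, {homo ginv : x y / x <= y}} \/
   {in D &, {homo ginv : x y /~ x <= y}}).

Section TSCF.
Context (R : realType) (K : nat) d (Omega : measurableType d)
        (P : probability Omega R).

(* The arms are 'I_K.  As in the algorithm, the samples [theta t] have indices
   t = 0, ..., T-1 and are used to choose [arm t.+1]; [arm t], the feedback
   [fb t] and the reward [rew t] have indices t = 1, ..., T. *)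
Definition history (arm : nat -> Omega -> 'I_K) (fb : nat -> {RV P >-> bool})
    (t : nat) (w : Omega) : seq ('I_K * bool) :=
  [seq (arm s w, fb s w) | s <- iota 1 t].

Definition successes (h : seq ('I_K * bool)) (a : 'I_K) : nat :=
  count_mem (a, true) h.

Definition failures (h : seq ('I_K * bool)) (a : 'I_K) : nat :=
  count_mem (a, false) h.

(* Given the first [t] rounds (arms and feedback) and the arm chosen in round
   t+1, [X] is Bernoulli with the mean [m a] of that arm [a].  The history takes
   finitely many values, so no conditional expectation is needed. *)
Definition bernoulli_draw (arm : nat -> Omega -> 'I_K)
    (fb : nat -> {RV P >-> bool}) (m : 'I_K -> R) (t : nat)
    (X : {RV P >-> bool}) : Prop :=
  forall (h : seq ('I_K * bool)) (a : 'I_K),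
    let E := [set w | history arm fb t w = h /\ arm t.+1 w = a] in
    (P (E `&` [set w | X w = true]) = (m a)%:E * P E)%E.

(* A run of Thompson sampling for corrupted feedback during [T] rounds.  Ties in
   the argmax may be broken in any way, and nothing is assumed about the joint
   law of the reward and the feedback of one round. *)
Record ts_cf_run (mu lambda : 'I_K -> R) (ginv : 'I_K -> R -> R) (T : nat)
    (theta : nat -> 'I_K -> {RV P >-> R}) (arm : nat -> Omega -> 'I_K)
    (fb rew : nat -> {RV P >-> bool}) : Prop := {
  measurable_arm : forall t a, (t < T)%N -> measurable [set w | arm t.+1 w = a] ;
  theta_beta : forall t (h : seq ('I_K * bool)) (B : 'I_K -> set R),
    (t < T)%N -> (forall a, measurable (B a)) ->
    let H := [set w | history arm fb t w = h] in
    (P (H `&` [set w | forall a, B a (theta t a w)]) =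
     P H * \prod_(a < K)
       beta_prob (successes h a + 1)%N (failures h a + 1)%N (B a))%E ;
  arm_argmax : forall t w a, (t < T)%N ->
    ginv a (theta t a w) <= ginv (arm t.+1 w) (theta t (arm t.+1 w) w) ;
  feedback_draw : forall t, (t < T)%N -> bernoulli_draw arm fb lambda t (fb t.+1) ;
  reward_draw : forall t, (t < T)%N -> bernoulli_draw arm fb mu t (rew t.+1)
}.

Definition regret (mu_opt : R) (rew : nat -> {RV P >-> bool}) (T : nat) : \bar R :=
  ('E_P[fun w => (mu_opt * T%:R - \sum_(1 <= t < T.+1) (rew t w)%:R)%R])%E.

End TSCF.

(* Main.v *)
(* Fix a suboptimal arm a and a level m slightly below mu ord0, and let p_b be the
   posterior probability that the sample of arm b exceeds m after inversion of g_b.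
   Given the history, arm a is pulled with probability at most p_a plus (1 - p_0) / p_0
   times the probability that arm 0 is pulled.  Summed over the rounds, the odds cost
   at most the sum over k of their expectation when the number of successes among k
   pulls of arm 0 is binomial, which is finite.  Apart from rounds where the empirical
   mean of arm a is atypical, whose expected number is bounded, p_a is at most 1/T up
   to a constant once arm a has been pulled ln T / e times, where e is any rate below
   kl_bernoulli (lambda a) (g a (mu ord0)) and m is close enough to mu ord0. *)
Require Import Defs.
From HB Require Import structures.
From mathcomp Require Import all_boot all_order all_algebra.
From mathcomp Require Import all_classical all_reals all_analysis.
From mathcomp Require Import measurable_realfun.
From mathcomp Require Import ring lra.
Import Order.TTheory GRing.Theory Num.Theory.
Import numFieldNormedType.Exports.
Local Open Scope classical_set_scope.
Local Open Scope ring_scope.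

(** * Posterior masses *)

(** The constant may depend neither on [T], nor on the probability space, nor on [ginv]. Hence every
    threshold is fixed from [mu], [lambda], [g] and [psi] alone, and every series of binomial
    expectations is bounded uniformly in its length. A run enters only through the probabilities of
    finite histories and of the next pull, which obey a recursion. The sharp rate for arm a comes
    from an exact likelihood ratio. The other exponential bounds come from log-concavity of the
    Bernoulli likelihood: its tangent compares two parameters, and so serves both as a change of
    measure for binomial weights and as a bound on Beta densities. Two obstacles shape the
    statements. Corruption functions may increase or decrease, so positions on the line are
    expressed by signs of products. Means of feedback may be 0 or 1, where logarithms degenerate, so
    the estimates go through auxiliary points inside []0, 1[]. *)

Section BetaWeights.
Context {R : realType}.
Implicit Types (x y a b c r M m lam : R) (s f n : nat) (B : set R).

(* The tangent of the concave function ln (XMonemX s f) at b, in multiplicative form. *)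
Lemma XMonemX_tangent s f a b : 0 <= a <= 1 -> 0 < b < 1 ->
  XMonemX s f a <= XMonemX s f b *
    expR ((a - b) * (s%:R - (s + f)%:R * b) / (b * (1 - b))).
Proof.
move=> /andP[a0 a1] /andP[b0 b1].
have b1' : 0 < 1 - b by rewrite subr_gt0.
have -> : (a - b) * (s%:R - (s + f)%:R * b) / (b * (1 - b)) =
    (a / b - 1) * s%:R + ((1 - a) / (1 - b) - 1) * f%:R.
  by rewrite natrD; field; rewrite !gt_eqF.
rewrite expRD !expRM_natr /XMonemX mulrACA -!exprMn.
have bnd u v : 0 < v -> u <= v * expR (u / v - 1).
  move=> v0; have := expR_ge1Dx (u / v - 1); rewrite addrCA subrr addr0.
  by rewrite ler_pdivrMr// mulrC.
by apply: ler_pM; rewrite ?exprn_ge0 ?subr_ge0//; apply: lerXn2r;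
  rewrite ?nnegrE ?subr_ge0 ?mulr_ge0 ?expR_ge0 ?(ltW b0) ?(ltW b1')//; exact: bnd.
Qed.

Lemma XMonemX_gt0 s f x : 0 < x < 1 -> 0 < XMonemX s f x.
Proof. by move=> /andP[x0 x1]; rewrite mulr_gt0// exprn_gt0// subr_gt0. Qed.

(** The sign condition says that the tangent at [b] does not rise towards [a]; a log-concave
    function stays below it. *)
Lemma XMonemX_le_mono s f a b : 0 <= a <= 1 -> 0 < b < 1 ->
  (a - b) * (s%:R - (s + f)%:R * b) <= 0 -> XMonemX s f a <= XMonemX s f b.
Proof.
move=> a01 b01 h; apply: le_trans (XMonemX_tangent s f a b a01 b01) _.
rewrite ler_piMr ?(ltW (XMonemX_gt0 _ _ _ b01))// expR_le1 pmulr_lle0//.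
by case/andP: b01 => b0 b1; rewrite invr_gt0 mulr_gt0// subr_gt0.
Qed.

(** The tangent exponent is divided by [b * (1 - b) <= 1], which only strengthens a negative
    exponent. *)
Lemma XMonemX_le_expR s f a b c : 0 <= a <= 1 -> 0 < b < 1 -> 0 <= c ->
  (a - b) * (s%:R - (s + f)%:R * b) <= - c ->
  XMonemX s f a <= XMonemX s f b * expR (- c).
Proof.
move=> a01 b01 c0 h; apply: le_trans (XMonemX_tangent s f a b a01 b01) _.
rewrite ler_pM2l ?XMonemX_gt0// ler_expR.
case/andP: b01 => b0 b1; rewrite ler_pdivrMr ?mulr_gt0 ?subr_gt0//.
apply: le_trans h _; rewrite mulNr lerN2 ler_piMr//; nra.
Qed.

Definition beta_mass s f B : R := fine (beta_prob (s + 1) (f + 1) B : \bar R).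

Lemma beta_massE s f B : measurable B ->
  (beta_mass s f B)%:E = beta_prob (s + 1) (f + 1) B.
Proof. by move=> mB; rewrite fineK//; exact: beta_prob_fin_num. Qed.

Lemma beta_mass_ge0 s f B : 0 <= beta_mass s f B.
Proof. exact: fine_ge0. Qed.

Lemma beta_mass_01 s f : beta_mass s f `]0, 1[%classic = 1.
Proof.
apply: EFin_inj; rewrite beta_massE// -(beta_prob01 (s + 1) (f + 1)).
have mpdf (D : set (measurableTypeR R)) :
    measurable_fun D (fun x => (beta_pdf (s + 1) (f + 1) x)%:E).
  by apply/measurable_funTS/measurable_EFinP; exact: measurable_beta_pdf.
rewrite -!integral_beta_pdf// integral_itv_bndo_bndc; last exact: mpdf.
by rewrite integral_itv_obnd_cbnd//; exact: mpdf.
Qed.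

Lemma beta_mass_le s f B M : measurable B -> 0 <= M -> B `<=` `]0, 1[ ->
  (forall x, B x -> XMonemX s f x <= M) ->
  beta_mass s f B <= M / beta_fun (s + 1) (f + 1).
Proof.
move=> mB M0 B01 BM.
rewrite -lee_fin beta_massE// -integral_beta_pdf//.
apply: (@le_trans _ _ (\int[lebesgue_measure]_(x in B)
  (M / beta_fun (s + 1) (f + 1))%:E)%E).
  apply: ge0_le_integral => //=.
  - by move=> x _; rewrite lee_fin beta_pdf_ge0.
  - by apply: measurable_funTS; apply/measurable_EFinP; exact: measurable_beta_pdf.
  - move=> x Bx; rewrite lee_fin /beta_pdf ler_pM2r ?invr_gt0 ?beta_fun_gt0//.
    by rewrite !addn1 patchE; case: ifPn => // _; exact: BM.
rewrite integral_cst//= -[leRHS]mule1.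
apply: lee_wpmul2l; first by rewrite lee_fin divr_ge0 ?beta_fun_ge0.
apply: (@le_trans _ _ (lebesgue_measure (`]0, 1[%classic : set R))).
  by apply: le_measure; rewrite ?inE.
by rewrite lebesgue_measure_itv/= lte01 EFinN sube0.
Qed.

Lemma beta_mass_ge s f B m c r : measurable B -> 0 <= m -> 0 < r ->
  B `<=` `]0, 1[ -> ball c r `<=` B ->
  (forall x, ball c r x -> m <= XMonemX s f x) ->
  (r *+ 2) * m / beta_fun (s + 1) (f + 1) <= beta_mass s f B.
Proof.
move=> mB m0 r0 B01 cB Bm.
rewrite -lee_fin beta_massE// -integral_beta_pdf//.
apply: (@le_trans _ _ (\int[lebesgue_measure]_(x in ball c r)
  (m / beta_fun (s + 1) (f + 1))%:E)%E).
  rewrite integral_cst//=; last exact: measurable_ball.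
  rewrite lebesgue_measure_ball ?(ltW r0)// -EFinM lee_fin.
  by rewrite le_eqVlt; apply/orP; left; apply/eqP; ring.
apply: (@le_trans _ _ (\int[lebesgue_measure]_(x in ball c r)
  (beta_pdf (s + 1) (f + 1) x)%:E)%E).
  apply: ge0_le_integral => //=.
  - exact: measurable_ball.
  - by move=> x _; rewrite lee_fin divr_ge0 ?beta_fun_ge0.
  - by apply: measurable_funTS; apply/measurable_EFinP; exact: measurable_beta_pdf.
  - move=> x Bx; rewrite lee_fin /beta_pdf ler_pM2r ?invr_gt0 ?beta_fun_gt0//.
    rewrite !addn1 patchE mem_set; first exact: Bm.
    by have /= := B01 _ (cB _ Bx); exact: subset_itvW.
apply: ge0_subset_integral => //=.
- exact: measurable_ball.
- by apply: measurable_funTS; apply/measurable_EFinP; exact: measurable_beta_pdf.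
- by move=> x _; rewrite lee_fin beta_pdf_ge0.
Qed.

(** Under the uniform prior the number of successes among [n] draws is uniform on [0, ..., n]. This
    identity trades a Beta normalization for a binomial coefficient. *)
Lemma bin_beta_fun n s : (s <= n)%N ->
  'C(n, s)%:R * beta_fun (s + 1) (n - s + 1) = n.+1%:R^-1 :> R.
Proof.
move=> sn; rewrite !addn1 beta_fun_fact subnKC// mulrA -natrM bin_fact//.
rewrite factS natrM invfM mulrCA divff ?mulr1//.
Qed.

End BetaWeights.

(** * Binomial expectations *)

Section BinomialExpectation.
Context {R : realType}.
Implicit Types (lam x : R) (phi psi : nat -> nat -> R) (s f n k : nat).

Definition binomial_mean lam k phi : R :=
  \sum_(s < k.+1) 'C(k, s)%:R * XMonemX s (k - s) lam * phi s (k - s)%N.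

Lemma binomial_mean0 lam phi : binomial_mean lam 0 phi = phi 0%N 0%N.
Proof. by rewrite /binomial_mean big_ord1 /= bin0 XMonemX00 !mul1r. Qed.

(** Conditioning on one draw: this is the form that the potential argument along histories
    consumes. *)
Lemma binomial_meanS lam k phi :
  binomial_mean lam k.+1 phi = lam * binomial_mean lam k (fun s f => phi s.+1 f) +
    (1 - lam) * binomial_mean lam k (fun s f => phi s f.+1).
Proof.
(* Indexing the weights by successes and failures gives Pascal's rule without subtraction; [b0] and
   [bl] are the boundary cases, where only one predecessor exists. *)
pose b s f : R := 'C(s + f, s)%:R * XMonemX s f lam.
have bE n h : binomial_mean lam n h = \sum_(s < n.+1) b s (n - s)%N * h s (n - s)%N.
  by apply: eq_bigr => -[s sn] _ /=; rewrite /b subnKC// -ltnS.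
have bS s f : b s.+1 f.+1 = lam * b s f.+1 + (1 - lam) * b s.+1 f.
  rewrite /b addSn binS natrD addSnnS.
  rewrite /XMonemX /unstable.onem !exprS; ring.
have b0 s : b s.+1 0%N = lam * b s 0%N.
  by rewrite /b !addn0 !binn !XMonemXn0 exprS mul1r mul1r.
have bl f : b 0%N f.+1 = (1 - lam) * b 0%N f.
  by rewrite /b !bin0 !XMonemX0n /unstable.onem exprS; ring.
clearbody b; rewrite !bE big_ord_recl big_ord_recr /= [in RHS]big_ord_recr.
rewrite [X in _ + (1 - lam) * X]big_ord_recl /=.
rewrite !subn0 !subnn bl b0.
under eq_bigr => i _.
  rewrite /bump /= add1n subSS -(subnSK (ltn_ord i)) bS mulrDl -!mulrA.
  over.
rewrite big_split /= -!mulr_sumr !mulrDr !mulrA.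
under [X in _ = _ + (_ + _ * X)]eq_bigr => i _.
  rewrite /bump /= add1n.
  over.
under [X in _ = _ * X + _ + _]eq_bigr => i _.
  rewrite -(subnSK (ltn_ord i)).
  over.
rewrite /bump /= add1n; ring.
Qed.

Lemma binomial_mean_ge0 lam k phi : 0 <= lam <= 1 -> (forall s f, 0 <= phi s f) ->
  0 <= binomial_mean lam k phi.
Proof.
move=> lam01 phi0; apply: sumr_ge0 => s _.
by rewrite mulr_ge0// mulr_ge0// XMonemX_ge0.
Qed.

Lemma binomial_mean_cst lam k (c : R) : binomial_mean lam k (fun _ _ => c) = c.
Proof. by elim: k => [|k ih]; rewrite ?binomial_mean0// binomial_meanS ih; ring. Qed.

Lemma binomial_mean_sum_counts (lam : R) (F : nat -> R) k :
  binomial_mean lam k (fun s f => F (s + f)%N) = F k.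
Proof.
rewrite -[RHS](binomial_mean_cst lam k); apply: eq_bigr => -[s] /=; rewrite ltnS => sk _.
by rewrite subnKC.
Qed.

(* Comparing signs through the products d * u and d * v treats increasing (d > 0) and
   decreasing (d < 0) corruption functions at once. *)
Lemma mul_ge_sign (d u v a b : R) : d != 0 -> 0 <= a -> 0 <= b ->
  a <= d * u -> b <= d * v -> a * b / d ^+ 2 <= u * v.
Proof.
move=> d0 a0 b0 au bv; rewrite ler_pdivrMr ?exprn_even_gt0//.
have -> : u * v * d ^+ 2 = (d * u) * (d * v) by ring.
exact: ler_pM.
Qed.

Lemma sum_expR_le (c : R) n : 0 < c ->
  \sum_(k < n) expR (- c) ^+ k <= (1 - expR (- c))^-1.
Proof.
move=> c0; have q1 : expR (- c) < 1 by rewrite expR_lt1 oppr_lt0.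
have h : (1 - expR (- c)) * \sum_(k < n) expR (- c) ^+ k = 1 - expR (- c) ^+ n.
  rewrite -[in RHS](expr1n _ n) subrXX; congr (_ * _).
  by apply: eq_bigr => i _; rewrite expr1n mul1r.
rewrite -[leRHS]mulr1 ler_pdivlMl ?subr_gt0// h.
by rewrite gerBl exprn_ge0 ?expR_ge0.
Qed.

(** Chernoff bound by change of measure: when the empirical mean lies beyond [x] as seen from [lam],
    each weight at [lam] is at most [expR (- c * k)] times the weight at the midpoint [b], and the
    weights at [b] sum to 1. *)
Lemma binomial_deviation_summable lam x : 0 <= lam <= 1 -> 0 <= x <= 1 -> x != lam ->
  exists2 C, 0 <= C & forall n, \sum_(k < n) binomial_mean lam k
    (fun s f => (0 <= (x - lam) * (s%:R - x * (s + f)%:R))%R%:R) <= C.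
Proof.
move=> lam01 x01 xl; set d := x - lam.
have d0 : d != 0 by rewrite subr_eq0.
have d2 : 0 < d ^+ 2 by rewrite exprn_even_gt0.
(* The midpoint is interior even if [lam] or [x] is 0 or 1. *)
pose b := lam + d / 2.
have b01 : 0 < b < 1.
  by move: lam01 x01 xl; rewrite /b /d neq_lt => /andP[? ?] /andP[? ?] /orP[?|?]; lra.
pose c := d ^+ 2 / 4; have c0 : 0 < c by rewrite divr_gt0.
exists (1 - expR (- c))^-1.
  by rewrite invr_ge0 subr_ge0 expR_le1 oppr_le0 ltW.
move=> n; apply: le_trans (sum_expR_le _ n c0); apply: ler_sum => k _.
rewrite -expRM_natr -(binomial_mean_cst b k (expR (- c * k%:R))).
apply: ler_sum => -[s] /=; rewrite ltnS => sk _; rewrite -[leLHS]mulrA -[leRHS]mulrA.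
apply: ler_wpM2l => //; rewrite subnKC//.
have [h|_] := boolP (0 <= d * _); last first.
  by rewrite mulr0 mulr_ge0 ?expR_ge0// ltW// XMonemX_gt0.
rewrite mulr1 mulNr; apply: XMonemX_le_expR => //; first by rewrite mulr_ge0// ltW.
rewrite subnKC// lerNr -mulNr opprB.
have := @mul_ge_sign d (b - lam) (s%:R - k%:R * b) (d ^+ 2 / 2) (d ^+ 2 / 2 * k%:R) d0.
rewrite (_ : _ / d ^+ 2 = c * k%:R); last by rewrite /c; field.
apply => //.
- by rewrite divr_ge0 ?sqr_ge0.
- by rewrite mulr_ge0// divr_ge0 ?sqr_ge0.
- by rewrite /b le_eqVlt; apply/orP; left; apply/eqP; field.
- rewrite -subr_ge0 (_ : _ - _ = d * (s%:R - x * k%:R))//.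
  rewrite /b (_ : x = lam + d); last by rewrite /d; ring.
  by field.
Qed.

End BinomialExpectation.

(** * Summability of posterior tails *)

Section BetaTails.
Context {R : realType}.
Implicit Types (lam x y t u : R) (s f n k : nat) (B : set R).

(** The product condition puts [x] strictly between [t] and [u], in either order. The slope
    condition makes [u] the lowest point of the likelihood there, so length times value at [u]
    bounds the integral from below. *)
Lemma beta_mass_ge_segment s f B t u : measurable B -> B `<=` `]0, 1[ ->
  0 < u < 1 -> t != u ->
  (forall x, 0 < (x - t) * (u - x) ->
    B x /\ (u - x) * (s%:R - (s + f)%:R * x) <= 0) ->
  `|u - t| * XMonemX s f u / beta_fun (s + 1) (f + 1) <= beta_mass s f B.
Proof.
move=> mB B01 u01 tu H.
have r0 : 0 < `|u - t| / 2 by rewrite divr_gt0// normr_gt0 subr_eq0 eq_sym.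
have inH x : ball ((t + u) / 2) (`|u - t| / 2) x -> 0 < (x - t) * (u - x).
  rewrite /ball /= -(ltr_pXn2r (n := 2)) ?nnegrE// ?(ltW r0)//.
  rewrite real_normK ?num_real// exprMn real_normK ?num_real// => h.
  rewrite (_ : (x - t) * (u - x) =
    (u - t) ^+ 2 * 2^-1 ^+ 2 - ((t + u) / 2 - x) ^+ 2); last by field.
  by rewrite subr_gt0.
have -> : `|u - t| * XMonemX s f u = (`|u - t| / 2) *+ 2 * XMonemX s f u.
  by congr (_ * _); field.
apply: (@beta_mass_ge _ _ _ _ _ ((t + u) / 2)) => //.
- by rewrite ltW// XMonemX_gt0.
- by move=> x /inH /H [].
- move=> x /inH /H [Bx h]; apply: XMonemX_le_mono => //.
    by case/andP: u01 => /ltW -> /ltW ->.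
  by have := B01 _ Bx; rewrite /= in_itv.
Qed.

Lemma beta_mass_compl s f B : measurable B -> B `<=` `]0, 1[ ->
  beta_mass s f (`]0, 1[ `\` B) = 1 - beta_mass s f B.
Proof.
move=> mB B01; rewrite -[X in X - _](beta_mass_01 s f).
apply/eqP; rewrite eq_sym subr_eq; apply/eqP.
have mD : measurable (`]0, 1[ `\` B : set R) by exact: measurableD.
apply: EFin_inj; rewrite EFinD !beta_massE//.
have DB0 : (`]0, 1[ `\` B) `&` B = set0.
  by apply/seteqP; split => // x [[_ nBx] Bx].
rewrite -(@measureU _ _ _ (@beta_prob R (s + 1) (f + 1)) _ _ mD mB DB0).
by rewrite setUC setDUK.
Qed.

Lemma mul_ge0_sign (d u v : R) : d != 0 -> 0 <= d * u -> 0 <= d * v -> 0 <= u * v.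
Proof.
move=> d0 du dv; have := mul_ge_sign _ _ _ _ _ d0 (lexx 0) (lexx 0) du dv.
by rewrite !mul0r.
Qed.

Lemma between_sign (d x t u : R) : 0 < d * (u - t) -> 0 < (x - t) * (u - x) ->
  0 < d * (x - t) /\ 0 < d * (u - x).
Proof.
move=> dut h.
have d0 : d != 0 by apply: contraTneq dut => ->; rewrite mul0r ltxx.
have : 0 < (d * (x - t)) * (d * (u - x)).
  by rewrite mulrACA -expr2 mulr_gt0// exprn_even_gt0.
have : 0 < d * (x - t) + d * (u - x) by rewrite -mulrDr addrC subrKA.
set p := d * _; set q := d * _ => pq pq'.
have [p0|p0|p0] := ltgtP 0 p.
- by move: pq'; rewrite pmulr_rgt0.
- by move: pq'; rewrite nmulr_rgt0// => q0; lra.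
- by move: pq'; rewrite -p0 mul0r ltxx.
Qed.

Lemma between_01 (x t u : R) : 0 < t < 1 -> 0 < u < 1 -> 0 < (x - t) * (u - x) ->
  0 < x < 1.
Proof.
move=> /andP[t0 t1] /andP[u0 u1] h; apply/andP; split; rewrite ltNge; apply/negP => hx;
  move: h; rewrite ltNge => /negP; apply.
  by rewrite mulr_le0_ge0//; lra.
by rewrite mulr_ge0_le0//; lra.
Qed.

(* Split according to the position of s / (s + f) relative to the midpoint z 2 of y and lam.
   On the side of lam, the complement of B has an exponentially small mass.  On the side of
   y, the Beta normalization cancels the binomial coefficient, and the remaining ratio
   XMonemX s f lam / XMonemX s f (z 3) is exponentially small. *)
Lemma beta_odds_summable_interior lam y : 0 <= lam <= 1 -> 0 < y < 1 -> y != lam ->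
  exists2 C, 0 <= C & forall B, measurable B -> B `<=` `]0, 1[ ->
    (forall x, 0 < x < 1 -> 0 < (lam - y) * (x - y) -> B x) ->
    (forall s f, 0 < beta_mass s f B) /\
    forall n, \sum_(k < n) binomial_mean lam k
      (fun s f => beta_mass s f (`]0, 1[ `\` B) / beta_mass s f B) <= C.
Proof.
move=> lam01 y01 ylam; set d := lam - y.
have d0 : d != 0 by rewrite subr_eq0 eq_sym.
have d2 : 0 < d ^+ 2 by rewrite exprn_even_gt0.
have d24 : 0 < d ^+ 2 / 4 by rewrite divr_gt0.
have nd : 0 < `|d| by rewrite normr_gt0.
(* Quarter points from [y = z 0] to [lam = z 4]. Below, [c] is the product of two displacements
   [d ^+ 2 / 4] divided by [d ^+ 2], and [D] is the inverse length of a quarter. *)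
pose z (i : R) := y + i * (d / 4).
have z01 i : 0 <= i -> i < 4 -> 0 < z i < 1.
  by move: lam01 y01 ylam => /andP[? ?] /andP[? ?] _ ? ?; rewrite /z /d; nra.
pose c := d ^+ 2 / 16; have c0 : 0 < c by rewrite divr_gt0.
pose D := 4 / `|d|; have D0 : 0 < D by rewrite divr_gt0.
exists (2 * D * (1 - expR (- c))^-1).
  by rewrite mulr_ge0 ?invr_ge0 ?subr_ge0 ?expR_le1 ?oppr_le0 ?(ltW c0)// mulr_ge0// ltW.
move=> B mB B01 HB.
have dz i j : d * (z i - z j) = (i - j) * (d ^+ 2 / 4) by rewrite /z; field.
have z0 : z 0 = y by rewrite /z mul0r addr0.
have z4 : z 4 = lam by rewrite /z /d; field.
(* Used for [i = 1] and [i = 3]: the segment from [z 2] to [z i] points away from the empirical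
   mean, so the likelihood is least at [z i]. *)
have low s f i : 0 < i -> i < 4 -> i != 2 ->
    0 <= (2 - i) * (d * (s%:R - (s + f)%:R * z 2)) ->
    `|z i - z 2| * XMonemX s f (z i) / beta_fun (s + 1) (f + 1) <= beta_mass s f B.
  move=> i0 i4 i2 h.
  have zi01 := z01 _ (ltW i0) i4; have z201 : 0 < z 2 < 1 by apply: z01; lra.
  apply: beta_mass_ge_segment => //.
    rewrite -subr_eq0; apply/eqP => e; move: (dz 2 i); rewrite e mulr0 => /esym/eqP.
    by rewrite mulf_eq0 (gt_eqF d24) orbF subr_eq0 eq_sym (negbTE i2).
  move=> x hx; have x01 := between_01 _ _ _ z201 zi01 hx.
  pose d' := (i - 2) * d.
  have [] : 0 < d' * (x - z 2) /\ 0 < d' * (z i - x).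
    apply: between_sign => //; rewrite -mulrA dz mulrA -expr2.
    by rewrite mulr_gt0// exprn_even_gt0//= subr_eq0.
  rewrite /d' -!mulrA => h1 h2; split.
    apply: HB => //; rewrite -z0.
    have [lt2|gt2|e] := ltgtP i 2; last by rewrite e eqxx in i2.
    - have h3 : d * (z i - x) < 0 by move: h2; rewrite nmulr_rgt0// subr_lt0.
      have : 0 < i * (d ^+ 2 / 4) by rewrite mulr_gt0.
      have := dz i 0; rewrite subr0; lra.
    - have h3 : 0 < d * (x - z 2) by move: h1; rewrite pmulr_rgt0// subr_gt0.
      have := dz 2 0; lra.
  rewrite -oppr_ge0 -mulrN; apply: (@mul_ge0_sign d') => //.
  - by rewrite mulf_neq0// subr_eq0.
  - by rewrite /d' -mulrA ltW.
  - have n0 : 0 <= (s + f)%:R :> R by [].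
    have : 0 <= (s + f)%:R * (((i - 2) * (d * (x - z 2)))) by rewrite mulr_ge0// ltW.
    rewrite /d'; move: h; set n := (s + f)%:R; lra.
have nz i : i = 1 \/ i = 3 -> `|z i - z 2| = D^-1.
  move=> i13; rewrite /D invf_div -(ger0_norm (_ : 0 <= 4 :> R))// -normf_div.
  rewrite /z (_ : _ - _ = (i - 2) * (d / 4)); last by field.
  rewrite normrM (_ : `|i - 2| = 1) ?mul1r//.
  by case: i13 => ->; [rewrite ler0_norm|rewrite ger0_norm]; lra.
clearbody z.
have z1_01 : 0 < z 1 < 1 by apply: z01; lra.
have z3_01 : 0 < z 3 < 1 by apply: z01; lra.
have low1 s f : 0 <= d * (s%:R - (s + f)%:R * z 2) ->
    D^-1 * XMonemX s f (z 1) / beta_fun (s + 1) (f + 1) <= beta_mass s f B.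
  move=> h; rewrite -(nz 1); last by left.
  by apply: low; [lra|lra|apply/eqP; lra|rewrite mulr_ge0//; lra].
have low3 s f : d * (s%:R - (s + f)%:R * z 2) <= 0 ->
    D^-1 * XMonemX s f (z 3) / beta_fun (s + 1) (f + 1) <= beta_mass s f B.
  move=> h; rewrite -(nz 3); last by right.
  by apply: low; [lra|lra|apply/eqP; lra|rewrite mulr_le0//; lra].
have mass0 s f : 0 < beta_mass s f B.
  have [h|/ltW h] := lerP 0 (d * (s%:R - (s + f)%:R * z 2)).
    apply: lt_le_trans (low1 _ _ h).
    by rewrite divr_gt0 ?beta_fun_gt0// mulr_gt0 ?invr_gt0// XMonemX_gt0.
  apply: lt_le_trans (low3 _ _ h).
  by rewrite divr_gt0 ?beta_fun_gt0// mulr_gt0 ?invr_gt0// XMonemX_gt0.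
split=> // n.
apply: (@le_trans _ _ (2 * D * \sum_(k < n) expR (- c) ^+ k)); last first.
  by rewrite ler_pM2l ?sum_expR_le// mulr_gt0.
rewrite mulr_sumr; apply: ler_sum => k _; rewrite -expRM_natr mulNr.
set q := expR _; have q0 : 0 < q by rewrite expR_gt0.
(* One share of [D * q] for each side of [z 2]: weighted by the binomial law on the side of [lam],
   and spread uniformly over the [k.+1] counts on the side of [y], as [bin_beta_fun] requires. *)
have -> : 2 * D * q = binomial_mean lam k (fun _ _ => D * q) + \sum_(s < k.+1) D * q / k.+1%:R.
  by rewrite binomial_mean_cst sumr_const card_ord -[_ *+ k.+1]mulr_natr divfK ?pnatr_eq0//; ring.
rewrite /binomial_mean -big_split /=; apply: ler_sum => -[s] /=; rewrite ltnS => sk _.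
have kE : k = (s + (k - s))%N :> nat by rewrite subnKC.
have nE : (s + (k - s))%:R = k%:R :> R by rewrite -kE.
set f := (k - s)%N in kE nE *.
have w0 : 0 <= 'C(k, s)%:R * XMonemX s f lam by rewrite mulr_ge0// XMonemX_ge0.
have b0 : 0 < beta_fun (s + 1) (f + 1) :> R by exact: beta_fun_gt0.
have [h|/ltW h] := lerP 0 (d * (s%:R - (s + f)%:R * z 2)).
  apply: ler_wpDr; first by rewrite divr_ge0// ltW// mulr_gt0.
  apply: ler_wpM2l => //; rewrite ler_pdivrMr//.
  apply: le_trans (_ : _ <= D * q * (D^-1 * XMonemX s f (z 1) / beta_fun (s + 1) (f + 1))) _.
    rewrite (_ : D * q * _ = XMonemX s f (z 1) * q / beta_fun (s + 1) (f + 1)); last first.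
      by field; rewrite !gt_eqF.
    apply: beta_mass_le.
    - exact: measurableD.
    - by rewrite mulr_ge0 ?(ltW q0)// ltW// XMonemX_gt0.
    - by move=> x [].
    move=> x [x01' nBx].
    have x01 : 0 < x < 1 by move: x01'; rewrite /= in_itv.
    apply: XMonemX_le_expR => //.
    - by case/andP: x01 => /ltW -> /ltW ->.
    - by rewrite mulr_ge0// ltW.
    rewrite lerNr -mulNr opprB.
    have dx : d * (x - z 0) <= 0.
      by rewrite leNgt; apply/negP => h'; apply: nBx; apply: HB => //; rewrite -z0.
    have := mul_ge_sign d (z 1 - x) (s%:R - (s + f)%:R * z 1) (d ^+ 2 / 4) (d ^+ 2 / 4 * k%:R) d0.
    rewrite (_ : _ / d ^+ 2 = c * k%:R); last by rewrite /c; field.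
    apply; [exact: ltW|by rewrite mulr_ge0// ltW| |].
    - have := dz 1 0; lra.
    - have := dz 2 1; rewrite nE in h *; set e := d ^+ 2 / 4 => E.
      rewrite -subr_ge0 (_ : _ - _ = d * (s%:R - k%:R * z 2)); first exact: h.
      rewrite (_ : e = d * (z 2 - z 1)); first ring.
      by rewrite E; lra.
  by apply: ler_wpM2l; [rewrite ltW// mulr_gt0|exact: low1].
apply: ler_wpDl; first by rewrite mulr_ge0// ltW// mulr_gt0.
rewrite -(bin_beta_fun k s sk) -/f.
have wl : XMonemX s f lam <= XMonemX s f (z 3) * q.
  apply: XMonemX_le_expR => //; first by rewrite mulr_ge0// ltW.
  rewrite lerNr -mulrN opprB.
  have := mul_ge_sign d (lam - z 3) ((s + f)%:R * z 3 - s%:R) (d ^+ 2 / 4) (d ^+ 2 / 4 * k%:R) d0.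
  rewrite (_ : _ / d ^+ 2 = c * k%:R); last by rewrite /c; field.
  apply; [exact: ltW|by rewrite mulr_ge0// ltW| |].
  - have := dz 4 3; rewrite z4; lra.
  - have := dz 3 2; rewrite nE in h *; set e := d ^+ 2 / 4 => E.
    rewrite -subr_ge0 (_ : _ - _ = - (d * (s%:R - k%:R * z 2))); first by rewrite oppr_ge0.
    rewrite (_ : e = d * (z 3 - z 2)); first ring.
    by rewrite E; lra.
rewrite -[leLHS]mulrA [leRHS]mulrCA; apply: ler_wpM2l => //.
rewrite mulrA ler_pdivrMr//.
apply: le_trans (_ : XMonemX s f (z 3) * q * 1 <= _).
  apply: ler_pM => //; first by rewrite XMonemX_ge0.
    exact: beta_mass_ge0.
  by rewrite beta_mass_compl// gerBl beta_mass_ge0.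
have := low3 _ _ h; rewrite ler_pdivrMr// mulrC ler_pdivrMr// => h3.
by have := ler_wpM2l (ltW q0) h3; lra.
Qed.

(** The level of the optimal arm may leave []0, 1[]. Then every sample is on the side of [lam], so
    [B] has full mass and the odds vanish. *)
Lemma beta_odds_summable lam y : 0 <= lam <= 1 -> y != lam ->
  exists2 C, 0 <= C & forall B, measurable B -> B `<=` `]0, 1[ ->
    (forall x, 0 < x < 1 -> 0 < (lam - y) * (x - y) -> B x) ->
    (forall s f, 0 < beta_mass s f B) /\
    forall n, \sum_(k < n) binomial_mean lam k
      (fun s f => beta_mass s f (`]0, 1[ `\` B) / beta_mass s f B) <= C.
Proof.
move=> lam01 ylam; have [y01|yN01] := boolP (0 < y < 1).
  exact: beta_odds_summable_interior.
exists 0 => // B mB B01 HB.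
have -> : B = `]0, 1[%classic.
  apply/seteqP; split=> // x /=; rewrite in_itv/= => x01; apply: HB => //.
  move: lam01 x01 ylam yN01; rewrite negb_and -!leNgt neq_lt.
  by move=> /andP[l0 l1] /andP[x0 x1] /orP[ylam|ylam] /orP[y0|y1]; nra.
split=> [s f|n]; first by rewrite beta_mass_01.
rewrite big1// => k _; rewrite /binomial_mean big1// => s _.
by rewrite setDv /beta_mass measure0 /= mul0r mulr0.
Qed.

(** Mean log-likelihood ratio of [t] against [y] under mean [x]; at [t = x] it is
    [kl_bernoulli x y]. Keeping [t] apart from [x] leaves a segment of positive length on which to
    bound the Beta normalization from below. *)
Definition kl_slack (x t y : R) : R :=
  x * ln (t / y) + (1 - x) * ln ((1 - t) / (1 - y)).

Lemma XMonemX_ratio s f t y : 0 < t < 1 -> 0 < y < 1 ->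
  XMonemX s f y = XMonemX s f t *
    expR (- (s%:R * ln (t / y) + f%:R * ln ((1 - t) / (1 - y)))).
Proof.
move=> /andP[t0 t1] /andP[y0 y1].
have t1' : 0 < 1 - t by rewrite subr_gt0.
have y1' : 0 < 1 - y by rewrite subr_gt0.
rewrite expRN expRD !expRM_natl !lnK ?posrE ?divr_gt0//.
rewrite /XMonemX /unstable.onem invfM -!exprVn !invf_div mulrACA -!exprMn.
by congr (_ ^+ _ * _ ^+ _); field; rewrite gt_eqF.
Qed.

(** The empirical mean, [x], [t], [y] come in this order along the line, in one direction or the
    other. The likelihood on [B] is then at most its value at [y], and the normalization is at least
    [|t - x|] times its value at [t]. *)
Lemma beta_tail_le (x t y : R) s f B : 0 <= x <= 1 -> 0 < t < 1 -> 0 < y < 1 ->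
  0 < (t - x) * (y - t) ->
  measurable B -> B `<=` `]0, 1[ -> (forall u, B u -> 0 <= (t - x) * (u - y)) ->
  (t - x) * (s%:R - (s + f)%:R * x) <= 0 ->
  beta_mass s f B <= expR (- ((s + f)%:R * kl_slack x t y)) / `|t - x|.
Proof.
move=> x01 t01 y01 txy mB B01 HB h; set n := (s + f)%:R; pose d := t - x.
have d0 : d != 0 by apply: contraTneq txy => /= d0; rewrite -/d d0 mul0r ltxx.
have nd : 0 < `|t - x| by rewrite normr_gt0.
have n0 : 0 <= n by [].
have b0 : 0 < beta_fun (s + 1) (f + 1) :> R by exact: beta_fun_gt0.
have dd : d * (t - x) = d ^+ 2 by [].
have d2 : 0 < d ^+ 2 by rewrite exprn_even_gt0.
have up : beta_mass s f B <= XMonemX s f y / beta_fun (s + 1) (f + 1).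
  apply: beta_mass_le => //; first by rewrite ltW// XMonemX_gt0.
  move=> u Bu; have := B01 _ Bu; rewrite /= in_itv /= => /andP[/ltW u0 /ltW u1].
  apply: XMonemX_le_mono => //; first by rewrite u0.
  rewrite -oppr_ge0 -mulrN; apply: (@mul_ge0_sign d) => //; first exact: HB.
  by rewrite -/n -/d in h txy *; nra.
have lo : `|t - x| * XMonemX s f t / beta_fun (s + 1) (f + 1) <= 1.
  rewrite -(beta_mass_01 s f); apply: beta_mass_ge_segment => //.
    by rewrite eq_sym -subr_eq0.
  move=> u hu.
  have [] : 0 < d * (u - x) /\ 0 < d * (t - u) by apply: between_sign => //; rewrite dd.
  move=> h1 h2; split.
    rewrite /= in_itv/=.
    move: t01 x01 hu => /andP[? ?] /andP[? ?] hu; apply/andP; split; rewrite ltNge;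
      apply/negP => hx; move: hu; rewrite ltNge => /negP; apply.
      by rewrite mulr_le0_ge0//; lra.
    by rewrite mulr_ge0_le0//; lra.
  rewrite -oppr_ge0 -mulrN; apply: (@mul_ge0_sign d) => //; first exact: ltW.
  by rewrite -/n -/d in h txy *; nra.
have yt : XMonemX s f y <= XMonemX s f t * expR (- (n * kl_slack x t y)).
  rewrite (XMonemX_ratio _ _ t y)// ler_pM2l ?XMonemX_gt0// ler_expR lerN2.
  set a := ln _; set b := ln _.
  (* The log-likelihood ratio [s * a + (n - s) * b] is affine in [s]; this sign makes [s = n * x]
     the worst case among the allowed counts. *)
  have ab : 0 <= d * (b - a).
    case/andP: (t01) => t0 t1; case/andP: (y01) => y0 y1.
    rewrite /d -/d in txy *; have [dn|dp|e] := ltgtP d 0; last by rewrite e eqxx in d0.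
    - have yt : y < t by move: txy; rewrite nmulr_rgt0// subr_lt0.
      rewrite mulr_le0//; first exact: ltW.
      rewrite subr_le0; apply: (@le_trans _ _ 0).
        by rewrite ln_le0// ler_pdivrMr ?mul1r ?subr_gt0//; lra.
      by rewrite ln_ge0// ler_pdivlMr// mul1r ltW.
    - have yt : t < y by move: txy; rewrite pmulr_rgt0// subr_gt0.
      rewrite mulr_ge0//; first exact: ltW.
      rewrite subr_ge0; apply: (@le_trans _ _ 0).
        by rewrite ln_le0// ler_pdivrMr// mul1r ltW.
      by rewrite ln_ge0// ler_pdivlMr ?mul1r ?subr_gt0//; lra.
  rewrite /kl_slack -/a -/b (_ : f%:R = n - s%:R); last first.
    by rewrite /n natrD; ring.
  have : 0 <= (n * x - s%:R) * (b - a).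
    apply: (@mul_ge0_sign d) => //; rewrite -/n -/d in h; lra.
  lra.
apply: le_trans up _; rewrite ler_pdivrMr//.
apply: le_trans yt _; set e := expR _.
have e0 : 0 < e by exact: expR_gt0.
rewrite [leRHS]mulrAC ler_pdivlMr//.
move: lo; rewrite ler_pdivrMr// mul1r => /(ler_wpM2l (ltW e0)); lra.
Qed.

(** Exchanging success and failure reduces the case [y < lam] to [lam < y]. *)
Lemma kl_slack_compl x t y : kl_slack (1 - x) (1 - t) (1 - y) = kl_slack x t y.
Proof. by rewrite /kl_slack !opprB ![1 + (_ - 1)]addrC !subrK addrC. Qed.

Lemma kl_bernoulli_gt0 lam y : 0 <= lam <= 1 -> 0 < y < 1 -> lam != y ->
  0 < kl_bernoulli lam y.
Proof.
move=> /andP[l0 l1] /andP[y0 y1] ly.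
(* Summed over the two outcomes, the linear terms [u - v] cancel, which leaves strict positivity. *)
have ln_gt (u v : R) : 0 <= u -> 0 < v -> u != v -> u - v < u * ln (u / v).
  move=> u0 v0 uv; have [->|u_neq0] := eqVneq u 0; first by rewrite mul0r sub0r oppr_lt0.
  have u_gt0 : 0 < u by rewrite lt_def u_neq0.
  have : 1 + ln (v / u) < expR (ln (v / u)).
    apply: expR_gt1Dx; rewrite ln_eq0 ?divr_gt0//.
    by apply: contra uv => /eqP vu; rewrite -[u]mul1r -vu divfK.
  rewrite lnK ?posrE ?divr_gt0//.
  have -> : ln (v / u) = - ln (u / v) by rewrite -lnV ?posrE ?divr_gt0// invf_div.
  by rewrite ltr_pdivlMr//; lra.
have := ln_gt lam y l0 y0 ly.
have : (1 - lam) - (1 - y) < (1 - lam) * ln ((1 - lam) / (1 - y)).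
  by apply: ln_gt; [lra|lra|apply: contra ly => /eqP e; apply/eqP; lra].
rewrite /kl_bernoulli; lra.
Qed.

Lemma near_right_point (a b : R) (Q : R -> Prop) : a < b -> (\forall t \near a, Q t) ->
  exists t, [/\ a < t, t < b & Q t].
Proof.
move=> ab nQ; have nQ' : \forall t \near a^'+, Q t.
  by rewrite near_withinE; apply: filterS nQ.
near a^'+ => t; exists t; split; near: t => //.
- exact: nbhs_right_gt.
- exact: nbhs_right_lt.
Unshelve. all: by end_near. Qed.

Lemma cvg_ln (T : Type) (F : set_system T) (FF : Filter F) (h : T -> R) (l : R) : 0 < l ->
  h z @[z --> F] --> l -> ln (h z) @[z --> F] --> ln l.
Proof. by move=> l0 hl; apply: cvg_comp hl _; exact: continuous_ln. Qed.

Lemma kl_slack_approx_lt lam y e : 0 <= lam -> lam < y -> y < 1 ->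
  e < kl_bernoulli lam y ->
  exists x t, [/\ lam < x, x < t, t < y & \forall y' \near y, e < kl_slack x t y'].
Proof.
move=> l0 ly y1 ekl; have y0 : 0 < y := le_lt_trans l0 ly.
(* The first logarithm is frozen at [lam]: for [lam = 0] it has no finite limit as [t] decreases to
   0. Since [lam < t], freezing gives a lower bound. *)
pose F t : R := lam * ln (lam / y) + (1 - lam) * ln ((1 - t) / (1 - y)).
have cF : F t @[t --> lam] --> kl_bernoulli lam y.
  apply: cvgD; first exact: cvg_cst.
  apply: cvgM; first exact: cvg_cst.
  apply: cvg_ln; first by rewrite divr_gt0// subr_gt0//; lra.
  apply: cvgM; last exact: cvg_cst.
  by apply: cvgB; [exact: cvg_cst|exact: cvg_id].
have [t [lt ty Ft]] := near_right_point _ _ _ ly (cvgr_gt _ cF _ ekl).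
have {}Ft : e < kl_slack lam t y.
  apply: lt_le_trans Ft _; rewrite lerD2r; have [->|ln0] := eqVneq lam 0.
    by rewrite !mul0r.
  have lam0 : 0 < lam by rewrite lt_def ln0.
  rewrite ler_pM2l// ler_ln ?posrE ?divr_gt0//; last lra.
  by rewrite ler_pM2r ?invr_gt0// ltW.
have cx : kl_slack x t y @[x --> lam] --> kl_slack lam t y.
  apply: cvgD; first by apply: cvgM; [exact: cvg_id|exact: cvg_cst].
  apply: cvgM; last exact: cvg_cst.
  by apply: cvgB; [exact: cvg_cst|exact: cvg_id].
have [x [lx xt Fx]] := near_right_point _ _ _ lt (cvgr_gt _ cx _ Ft).
exists x, t; split => //.
suff cy : kl_slack x t y' @[y' --> y] --> kl_slack x t y by exact: cvgr_gt cy _ Fx.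
apply: cvgD; (apply: cvgM; first exact: cvg_cst); apply: cvg_ln.
- by rewrite divr_gt0//; lra.
- apply: cvgM; first exact: cvg_cst.
  by apply: cvgV; [rewrite gt_eqF|exact: cvg_id].
- by rewrite divr_gt0//; lra.
- apply: cvgM; first exact: cvg_cst.
  apply: cvgV; first by rewrite gt_eqF// subr_gt0.
  by apply: cvgB; [exact: cvg_cst|exact: cvg_id].
Qed.

Lemma kl_slack_approx lam y e : 0 <= lam <= 1 -> 0 < y < 1 -> lam != y ->
  e < kl_bernoulli lam y ->
  exists x t, [/\ 0 <= x <= 1, 0 < t < 1, 0 < (y - lam) * (x - lam),
    0 < (y - lam) * (t - x) & \forall y' \near y,
    [/\ 0 < y' < 1, 0 < (t - x) * (y' - t) & e < kl_slack x t y']].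
Proof.
move=> /andP[l0 l1] /andP[y0 y1] ly ekl.
have near_lt (a : R) : a < y -> \forall y' \near y, a < y'.
  by move=> ay; apply: (cvgr_gt _ (@cvg_id _ (nbhs y))).
have near_gt (a : R) : y < a -> \forall y' \near y, y' < a.
  by move=> ay; apply: (cvgr_lt _ (@cvg_id _ (nbhs y))).
move: (ly); rewrite neq_lt => /orP[lty|gty].
  have [x [t [lx xt ty H]]] := kl_slack_approx_lt _ _ _ l0 lty y1 ekl.
  exists x, t; split.
  - by apply/andP; split; lra.
  - by apply/andP; split; lra.
  - by rewrite mulr_gt0// subr_gt0.
  - by rewrite mulr_gt0// subr_gt0.
  near=> y'; split.
  - apply/andP; split; near: y'; [exact: near_lt|exact: near_gt].
  - rewrite mulr_gt0// subr_gt0//; near: y'; exact: near_lt.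
  - by near: y'.
have e' : e < kl_bernoulli (1 - lam) (1 - y).
  by rewrite -[kl_bernoulli _ _]/(kl_slack _ _ _) kl_slack_compl.
have [||| x [t [lx xt ty H]]] := kl_slack_approx_lt (1 - lam) (1 - y) e _ _ _ e'; [lra..|].
exists (1 - x), (1 - t); split.
- by apply/andP; split; lra.
- by apply/andP; split; lra.
- by rewrite nmulr_rgt0; lra.
- by rewrite nmulr_rgt0; lra.
have H' : \forall y' \near y, e < kl_slack x t (1 - y').
  have c : 1 - y' @[y' --> y] --> 1 - y by apply: cvgB; [exact: cvg_cst|exact: cvg_id].
  exact: c H.
near=> y'; split.
- apply/andP; split; near: y'; [exact: near_lt|exact: near_gt].
- have : y' < 1 - t by near: y'; apply: near_gt; lra.
  by move=> ?; rewrite nmulr_rgt0; lra.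
- have h : e < kl_slack x t (1 - y') by near: y'.
  by rewrite -kl_slack_compl !opprB ![1 + (_ - 1)]addrC !subrK.
Unshelve. all: by end_near. Qed.

(* [bad] holds when the empirical mean lies beyond a point strictly between [lam] and [y]. *)
Lemma beta_tail_rate lam y e : 0 <= lam <= 1 -> 0 < y < 1 -> lam != y ->
  e < kl_bernoulli lam y ->
  exists D C (bad : nat -> nat -> bool), [/\ 0 <= D, 0 <= C,
    forall n, \sum_(k < n) binomial_mean lam k (fun s f => (bad s f)%:R) <= C &
    \forall y' \near y, forall B, measurable B -> B `<=` `]0, 1[ ->
      (forall u, B u -> 0 <= (y - lam) * (u - y')) ->
      forall s f, ~~ bad s f -> beta_mass s f B <= D * expR (- ((s + f)%:R * e))].
Proof.
move=> lam01 y01 ly ekl.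
have [x [t [x01 t01 lx xt H]]] := kl_slack_approx _ _ _ lam01 y01 ly ekl.
have xl : x != lam by apply: contraTneq lx => ->; rewrite subrr mulr0 ltxx.
have [C C0 HC] := binomial_deviation_summable _ _ lam01 x01 xl.
(* The witnesses depend on [x] and [t] only, so they serve all [y'] near [y]; the level is chosen
   later, by continuity. *)
exists (`|t - x|^-1), C, (fun s f => 0 <= (x - lam) * (s%:R - x * (s + f)%:R)).
split => //.
near=> y'.
have [y'01 txy' ey'] : [/\ 0 < y' < 1, 0 < (t - x) * (y' - t) & e < kl_slack x t y'].
  by near: y'.
move=> B mB B01 HB s f; rewrite -ltNge => nbad.
have d0 : y - lam != 0 by rewrite subr_eq0 eq_sym.
apply: le_trans (beta_tail_le _ t y' _ _ _ x01 t01 y'01 txy' mB B01 _ _) _.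
- by move=> u Bu; apply: (@mul_ge0_sign (y - lam)) => //; [exact: ltW|exact: HB].
- rewrite [_%:R * x]mulrC; move: lx xt nbad.
  have [dn|dp|d0'] := ltgtP (y - lam) 0; last by rewrite d0' eqxx in d0.
    rewrite !nmulr_rgt0// => lx xt; rewrite nmulr_rlt0// => h.
    by rewrite mulr_le0_ge0// ltW.
  rewrite !pmulr_rgt0// => lx xt; rewrite pmulr_rlt0// => h.
  by rewrite mulr_ge0_le0// ltW.
rewrite [leRHS]mulrC; apply: ler_wpM2r; first by rewrite invr_ge0.
by rewrite ler_expR lerN2 ler_wpM2l// ltW.
Unshelve. all: by end_near. Qed.

End BetaTails.

(** * Pulls of an arm along random histories *)

Lemma sum_le_nat (R : realType) (L : R) n : 0 <= L -> \sum_(k < n) (k%:R <= L)%R%:R <= L + 1.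
Proof.
move=> L0.
elim: n => [|n ih]; first by rewrite big_ord0; lra.
rewrite big_ord_recr /=; have [nL|_] := boolP (n%:R <= L); last by rewrite addr0.
rewrite lerD//; apply: le_trans nL.
apply: (@le_trans _ _ (\sum_(i < n) 1)); last by rewrite sumr_const card_ord.
by apply: ler_sum => i _; rewrite -[leRHS]mulr1n ler_nat leq_b1.
Qed.

Section Histories.
Context {K : nat}.
Implicit Types (h : seq ('I_K * bool)) (a b : 'I_K) (t : nat).

Fixpoint histories t : seq (seq ('I_K * bool)) :=
  if t is t'.+1 then
    [seq rcons h x | h <- histories t', x <- index_enum ('I_K * bool)%type]
  else [:: [::]].

Lemma size_histories t h : h \in histories t -> size h = t.
Proof.
elim: t h => [|t ih] h /=; first by rewrite inE => /eqP ->.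
by move=> /allpairsP[[h' x] /= [/ih h't _ ->]]; rewrite size_rcons h't.
Qed.

Lemma successes_rcons h a b v :
  successes (rcons h (b, v)) a = (successes h a + ((b == a) && v))%N.
Proof. by rewrite /successes -cats1 count_cat /= addn0 xpair_eqE; case: v. Qed.

Lemma failures_rcons h a b v :
  failures (rcons h (b, v)) a = (failures h a + ((b == a) && ~~ v))%N.
Proof. by rewrite /failures -cats1 count_cat /= addn0 xpair_eqE; case: v. Qed.

Section Law.
Context {R : realType}.
(** [w h] models the probability of the history [h], and [q h a] that of [h] followed by a pull of
    [a]. *)
Variables (T : nat) (lambda : 'I_K -> R) (w : seq ('I_K * bool) -> R)
  (q : seq ('I_K * bool) -> 'I_K -> R).
Hypothesis lambda01 : forall a, 0 <= lambda a <= 1.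
Hypothesis w_nil : w [::] = 1.
Hypothesis q_ge0 : forall h a, 0 <= q h a.
Hypothesis sum_q : forall h, (size h < T)%N -> \sum_a q h a = w h.
Hypothesis w_rcons : forall h a (v : bool), (size h < T)%N ->
  w (rcons h (a, v)) = (if v then lambda a else 1 - lambda a) * q h a.

Lemma sum_histories_step (F : seq ('I_K * bool) -> R) t : (t < T)%N ->
  \sum_(h <- histories t.+1) w h * F h =
  \sum_(h <- histories t) \sum_a q h a *
    (lambda a * F (rcons h (a, true)) + (1 - lambda a) * F (rcons h (a, false))).
Proof.
move=> tT; rewrite /= big_allpairs_dep /= big_seq [RHS]big_seq.
apply: eq_bigr => h /size_histories ht.
pose G a (v : bool) :=
  (if v then lambda a else 1 - lambda a) * q h a * F (rcons h (a, v)).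
rewrite (eq_bigr (fun x => G x.1 x.2)) => [|[a v] _]; last by rewrite w_rcons ?ht.
rewrite -(pair_bigA _ G) /=.
by apply: eq_bigr => a _; rewrite big_bool /G /=; ring.
Qed.

Lemma w_ge0 h : (size h <= T)%N -> 0 <= w h.
Proof.
elim/last_ind: h => [|h [a v] _]; first by rewrite w_nil.
rewrite size_rcons => hT; rewrite w_rcons// mulr_ge0//.
by have /andP[l0 l1] := lambda01 a; case: v; rewrite ?subr_ge0.
Qed.

Lemma sum_w t : (t <= T)%N -> \sum_(h <- histories t) w h = 1.
Proof.
elim: t => [|t ih] tT; first by rewrite /= big_seq1.
rewrite -(ih (ltnW tT)).
under eq_bigr do rewrite -[w _]mulr1.
rewrite (sum_histories_step (fun=> 1))// big_seq [RHS]big_seq.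
apply: eq_bigr => h /size_histories ht; rewrite -sum_q ?ht//.
by apply: eq_bigr => a _; ring.
Qed.

(* The potential V is the expected future cost of an arm pulled at every remaining round:
   in expectation it decreases by at least phi when the arm is pulled. *)
Lemma sum_pulls_le a (phi : nat -> nat -> R) : (forall s f, 0 <= phi s f) ->
  \sum_(t < T) \sum_(h <- histories t) q h a * phi (successes h a) (failures h a)
  <= \sum_(k < T) binomial_mean (lambda a) k phi.
Proof.
move=> phi0.
pose V n s f := \sum_(k < n) binomial_mean (lambda a) k (fun i j => phi (s + i)%N (f + j)%N).
have VS n s f : V n.+1 s f = phi s f +
    (lambda a * V n s.+1 f + (1 - lambda a) * V n s f.+1).
  rewrite /V big_ord_recl binomial_mean0 !addn0 !mulr_sumr -big_split /=; congr (_ + _).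
  apply: eq_bigr => k _; rewrite binomial_meanS.
  by congr (_ * binomial_mean _ _ _ + _ * binomial_mean _ _ _);
    apply/funext => i; apply/funext => j; rewrite addSnnS.
have V_ge n s f : V n s f <= V n.+1 s f.
  by rewrite /V big_ord_recr /= lerDl binomial_mean_ge0.
have V0 n s f : 0 <= V n s f by apply: sumr_ge0 => k _; exact: binomial_mean_ge0.
pose Vh n h := V n (successes h a) (failures h a).
(* Invariant: the cost already paid plus the expected potential of the remaining rounds never
   exceeds the initial potential. *)
suff H u : (u <= T)%N ->
    \sum_(t < u) \sum_(h <- histories t) q h a * phi (successes h a) (failures h a)
    + \sum_(h <- histories u) w h * Vh (T - u)%N h <= V T 0%N 0%N.
  rewrite [leRHS](_ : _ = V T 0%N 0%N)//.
  apply: le_trans _ (H T (leqnn _)); rewrite lerDl big_seq sumr_ge0// => h.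
  by move=> /size_histories hT; rewrite mulr_ge0 ?V0// w_ge0 ?hT.
elim: u => [|u ih] uT.
  by rewrite big_ord0 add0r /= big_seq1 w_nil mul1r subn0.
apply: le_trans _ (ih (ltnW uT)); rewrite big_ord_recr /= -addrA lerD2l.
rewrite -[X in \sum_(h <- X) w h * _]/(histories u.+1) sum_histories_step//.
rewrite -big_split /= big_seq [leRHS]big_seq; apply: ler_sum => h /size_histories hu.
rewrite -sum_q ?hu// mulr_suml (bigD1 a)//= [leRHS](bigD1 a)//= addrA.
rewrite -(subnSK uT) lerD//.
  rewrite /Vh VS !successes_rcons !failures_rcons !eqxx /= !addn0 !addn1.
  by rewrite -mulrDr.
(* Pulling another arm leaves the counts of [a] unchanged, and a shorter horizon can only lower
   [V]. *)
apply: ler_sum => b ba; rewrite ler_wpM2l// /Vh !successes_rcons !failures_rcons.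
by rewrite (negbTE ba) /= !addn0 -mulrDl addrC subrK mul1r.
Qed.

(** At most [ln T / e + 1] pulls occur while the count of [a] is at most [ln T / e]. Atypical counts
    cost [C1], the other rounds cost at most [D / T] each through [p], and the odds cost [C2]. *)
Lemma arm_pulls_le (a o : 'I_K) (p odds : nat -> nat -> R) (bad : nat -> nat -> bool)
    (e D C1 C2 : R) : 0 < e -> 0 <= D ->
  (forall s f, 0 <= odds s f) ->
  (forall s f, ~~ bad s f -> p s f <= D * expR (- ((s + f)%:R * e))) ->
  (forall n, \sum_(k < n) binomial_mean (lambda a) k (fun s f => (bad s f)%:R) <= C1) ->
  (forall n, \sum_(k < n) binomial_mean (lambda o) k odds <= C2) ->
  (forall h, (size h < T)%N ->
    q h a <= w h * p (successes h a) (failures h a)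
      + odds (successes h o) (failures h o) * q h o) ->
  \sum_(t < T) \sum_(h <- histories t) q h a <= ln T%:R / e + (1 + C1 + D + C2).
Proof.
move=> e0 D0 odds0 pD HC1 HC2 Hq.
(* For [T = 0] the logarithm is 0 by convention, and [C1], [C2] are nonnegative as bounds of empty
   sums. *)
have [T0|T0] := posnP T.
  rewrite T0 big_ord0 ln0// mul0r add0r.
  have := HC1 0%N; have := HC2 0%N; rewrite !big_ord0; lra.
have lnT0 : 0 <= ln T%:R :> R by rewrite ln_ge0// ler1n.
pose small (s f : nat) : R := ((s + f)%:R <= ln T%:R / e)%R%:R.
have hs : \sum_(t < T) \sum_(h <- histories t)
    q h a * small (successes h a) (failures h a) <= ln T%:R / e + 1.
  apply: le_trans (sum_pulls_le a small _) _; first by move=> s f; rewrite /small ler0n.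
  under eq_bigr do rewrite (binomial_mean_sum_counts _ (fun n => (n%:R <= ln T%:R / e)%R%:R)).
  by apply: sum_le_nat; rewrite divr_ge0// ltW.
have hb := le_trans (sum_pulls_le a (fun s f => (bad s f)%:R) (fun s f => ler0n _ _)) (HC1 T).
have ho := le_trans (sum_pulls_le o odds odds0) (HC2 T).
have hw : \sum_(t < T) \sum_(h <- histories t) w h * (D / T%:R) = D.
  rewrite (eq_bigr (fun=> D / T%:R)) => [|t _].
    by rewrite sumr_const card_ord -[_ *+ T]mulr_natr divfK// pnatr_eq0 -lt0n.
  rewrite -mulr_suml sum_w ?mul1r//.
  exact/ltnW/ltn_ord.
have : \sum_(t < T) \sum_(h <- histories t) q h a <=
    \sum_(t < T) \sum_(h <- histories t) (
      q h a * small (successes h a) (failures h a) +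
      q h a * (bad (successes h a) (failures h a))%:R +
      w h * (D / T%:R) + q h o * odds (successes h o) (failures h o)).
  apply: ler_sum => t _; rewrite big_seq [leRHS]big_seq; apply: ler_sum => h.
  move=> /size_histories ht; have hT : (size h < T)%N by rewrite ht.
  have wh : 0 <= w h by rewrite -sum_q//; apply: sumr_ge0.
  have qo : 0 <= q h o * odds (successes h o) (failures h o) by rewrite mulr_ge0.
  have DT : 0 <= w h * (D / T%:R) by rewrite mulr_ge0// divr_ge0.
  have qa := q_ge0 h a; have qh := Hq _ hT; rewrite mulrC in qo qh.
  set s := successes h a in qh *; set f := failures h a in qh *.
  rewrite /small; have [sm|lg] := boolP (_ <= ln _ / e); have [b|nb] := boolP (bad s f);
    rewrite ?mulr1 ?mulr0; [lra|lra|lra|].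
  have : w h * p s f <= w h * (D / T%:R).
    apply: ler_wpM2l => //; apply: le_trans (pD _ _ nb) _; apply: ler_wpM2l => //.
    rewrite -[_^-1](@lnK R) ?posrE ?invr_gt0 ?ltr0n// ler_expR lnV ?posrE ?ltr0n//.
    by rewrite lerN2 -ler_pdivrMr// ltW// ltNge.
  lra.
move=> H; apply: le_trans H _.
under eq_bigr do rewrite !big_split /=.
rewrite !big_split /=; lra.
Qed.

End Law.
End Histories.

(** * The law of a run *)

Section Probability.
Context {d : measure_display} {Omega : measurableType d} {R : realType}
  (P : probability Omega R).
Implicit Types (A B : set Omega).

Definition pr A : R := fine (P A).

Lemma prE A : measurable A -> (pr A)%:E = P A.
Proof. by move=> mA; rewrite fineK// fin_num_measure. Qed.

Lemma pr_ge0 A : 0 <= pr A.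
Proof. exact: fine_ge0. Qed.

Lemma pr_setT : pr setT = 1.
Proof. by rewrite /pr probability_setT. Qed.

Lemma le_pr A B : measurable A -> measurable B -> A `<=` B -> pr A <= pr B.
Proof. by move=> mA mB AB; rewrite -lee_fin !prE// le_measure// inE. Qed.

Lemma pr_setU_disjoint A B : measurable A -> measurable B -> A `&` B = set0 ->
  pr (A `|` B) = pr A + pr B.
Proof.
move=> mA mB AB; apply: EFin_inj; rewrite EFinD !prE//; last exact: measurableU.
exact: measureU.
Qed.

Lemma pr_partition (I : finType) (Y : Omega -> I) A : measurable A ->
  (forall i, measurable (A `&` [set w | Y w = i])) ->
  \sum_i pr (A `&` [set w | Y w = i]) = pr A.
Proof.
move=> mA mY.
have [] : measurable (A `&` [set w | Y w \in index_enum I]) /\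
    \sum_(i <- index_enum I) pr (A `&` [set w | Y w = i]) =
    pr (A `&` [set w | Y w \in index_enum I]).
  elim: (index_enum I) (index_enum_uniq I) => [_|i s ih] /=.
    rewrite big_nil (_ : A `&` _ = set0); last by apply/seteqP; split => // x [].
    by split; [exact: measurable0|rewrite /pr measure0].
  move=> /andP[si /ih[ms es]]; rewrite big_cons es.
  have -> : A `&` [set w | Y w \in i :: s] =
      (A `&` [set w | Y w = i]) `|` (A `&` [set w | Y w \in s]).
    rewrite -setIUr; congr (_ `&` _); apply/seteqP; split => x /=; rewrite inE.
      by move=> /orP[/eqP ?|?]; [left|right].
    by move=> [->|->]; rewrite ?eqxx ?orbT.
  split; first exact: measurableU.
  rewrite pr_setU_disjoint//; apply/seteqP; split => // x [[_ /= ->] [_ /=]].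
  by rewrite (negbTE si).
move=> _ ->; congr pr; apply/seteqP; split => [x []//|x Ax]; split => //=.
exact: mem_index_enum.
Qed.

Lemma pr_setU A B : measurable A -> measurable B -> pr (A `|` B) <= pr A + pr B.
Proof.
move=> mA mB; rewrite -lee_fin EFinD !prE//; last exact: measurableU.
exact: measureU2.
Qed.

Lemma pr_setD A B : measurable A -> measurable B -> B `<=` A ->
  pr (A `\` B) = pr A - pr B.
Proof.
move=> mA mB BA; apply/eqP; rewrite eq_sym subr_eq; apply/eqP.
rewrite -pr_setU_disjoint//; last 2 first.
- exact: measurableD.
- by apply/seteqP; split => // x [[_ nBx] Bx].
by rewrite setUC setDUK.
Qed.

End Probability.

Section Run.
Context {R : realType} {K : nat} {d : measure_display} {Omega : measurableType d}
  (P : probability Omega R).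
Variables (mu lambda : 'I_K -> R) (ginv : 'I_K -> R -> R) (T : nat)
  (theta : nat -> 'I_K -> {RV P >-> R}) (arm : nat -> Omega -> 'I_K)
  (fb rew : nat -> {RV P >-> bool}).
Hypothesis run : ts_cf_run mu lambda ginv T theta arm fb rew.
Implicit Types (h : seq ('I_K * bool)) (a b o : 'I_K) (t : nat).

Definition hist_event h : set Omega := [set x | history arm fb (size h) x = h].
Definition arm_event t a : set Omega := [set x | arm t x = a].
Definition prob_hist h : R := pr P (hist_event h).
Definition prob_pull h a : R := pr P (hist_event h `&` arm_event (size h).+1 a).

Lemma measurable_bool_event (X : {RV P >-> bool}) v : measurable [set x | X x = v].
Proof. by have := @measurable_funPTI _ _ _ _ X [set v]; apply. Qed.

Lemma hist_event_rcons h a v :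
  hist_event (rcons h (a, v)) =
    (hist_event h `&` arm_event (size h).+1 a) `&` [set x | fb (size h).+1 x = v].
Proof.
have hS t x : history arm fb t.+1 x = rcons (history arm fb t x) (arm t.+1 x, fb t.+1 x).
  rewrite /history (_ : iota 1 t.+1 = rcons (iota 1 t) t.+1) ?map_rcons//.
  by rewrite -cats1 -[in LHS](addn1 t) iotaD.
rewrite /hist_event /arm_event size_rcons; apply/seteqP; split => x /=; rewrite hS.
  by move=> /rcons_inj [].
by move=> [[-> ->] ->].
Qed.

Lemma measurable_arm_event t a : (t < T)%N -> measurable (arm_event t.+1 a).
Proof. by move=> tT; exact: measurable_arm run _ _ tT. Qed.

Lemma measurable_hist_event h : (size h <= T)%N -> measurable (hist_event h).
Proof.
elim/last_ind: h => [_|h [a v] ih].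
  by rewrite (_ : hist_event _ = setT)//; apply/seteqP.
rewrite size_rcons => hT; rewrite hist_event_rcons.
apply: measurableI; last exact: measurable_bool_event.
by apply: measurableI; [exact/ih/ltnW|exact: measurable_arm_event].
Qed.

Lemma measurable_pull_event h a : (size h < T)%N ->
  measurable (hist_event h `&` arm_event (size h).+1 a).
Proof.
move=> hT; apply: measurableI; first exact/measurable_hist_event/ltnW.
exact: measurable_arm_event.
Qed.

Lemma prob_hist_nil : prob_hist [::] = 1.
Proof.
by rewrite /prob_hist (_ : hist_event _ = setT) ?pr_setT//; apply/seteqP.
Qed.

Lemma prob_pull_ge0 h a : 0 <= prob_pull h a.
Proof. exact: pr_ge0. Qed.

Lemma sum_prob_pull h : (size h < T)%N -> \sum_a prob_pull h a = prob_hist h.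
Proof.
move=> hT; apply: pr_partition; first exact/measurable_hist_event/ltnW.
by move=> a; exact: measurable_pull_event.
Qed.

Lemma pr_draw (m : 'I_K -> R) (X : {RV P >-> bool}) h a : (size h < T)%N ->
  bernoulli_draw arm fb m (size h) X ->
  pr P ((hist_event h `&` arm_event (size h).+1 a) `&` [set x | X x = true]) =
  m a * prob_pull h a.
Proof.
move=> hT draw; apply: EFin_inj; rewrite EFinM !prE//.
- exact: draw.
- exact: measurable_pull_event.
- by apply: measurableI; [exact: measurable_pull_event|exact: measurable_bool_event].
Qed.

Lemma prob_hist_rcons h a (v : bool) : (size h < T)%N ->
  prob_hist (rcons h (a, v)) = (if v then lambda a else 1 - lambda a) * prob_pull h a.
Proof.
move=> hT; rewrite /prob_hist hist_event_rcons.
have dr := pr_draw _ _ h a hT (feedback_draw run hT).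
case: v => //; rewrite mulrBl mul1r -dr.
have mE := measurable_pull_event h a hT.
rewrite -pr_setD//.
- congr (pr P _); apply/seteqP; split => x /= [Hx fx]; split => //; first by rewrite fx; case.
  by case: (fb _ x) fx => // fx; exfalso; apply: fx.
- by apply: measurableI => //; exact: measurable_bool_event.
Qed.

Lemma sum_hist_event A t : (t <= T)%N -> measurable A ->
  \sum_(h <- histories t) pr P (hist_event h `&` A) = pr P A.
Proof.
move=> + mA; elim: t => [|t ih] tT.
  rewrite /= big_seq1 (_ : hist_event _ = setT) ?setTI//; exact/seteqP.
rewrite -ih ?(ltnW tT)//= big_allpairs_dep /= big_seq [RHS]big_seq.
apply: eq_bigr => h /size_histories ht; have hT : (size h < T)%N by rewrite ht.
have mh x : measurable (hist_event (rcons h x)).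
  by apply: measurable_hist_event; rewrite size_rcons.
have E x : hist_event (rcons h x) `&` A = (hist_event h `&` A) `&`
    [set y | (arm (size h).+1 y, fb (size h).+1 y : bool) = x].
  case: x => a v; rewrite hist_event_rcons; apply/seteqP; split => y /=.
    by move=> [[[? ->] ->] ?].
  by move=> [[? ?] [? ?]].
under eq_bigr do rewrite E.
apply: pr_partition => [|x]; last by rewrite -E; exact: measurableI.
by apply: measurableI => //; exact/measurable_hist_event/ltnW.
Qed.

Lemma pr_reward t : (t < T)%N -> pr P [set x | rew t.+1 x = true] =
  \sum_(h <- histories t) \sum_a mu a * prob_pull h a.
Proof.
move=> tT; rewrite -(sum_hist_event _ t (ltnW tT)); last exact: measurable_bool_event.
rewrite big_seq [RHS]big_seq; apply: eq_bigr => h /size_histories ht.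
have hT : (size h < T)%N by rewrite ht.
have mr : measurable [set x | rew t.+1 x = true] by exact: measurable_bool_event.
have E a : (hist_event h `&` [set x | rew t.+1 x = true]) `&` [set x | arm (size h).+1 x = a] =
  (hist_event h `&` arm_event (size h).+1 a) `&` [set x | rew t.+1 x = true].
  by rewrite setIAC.
rewrite -(pr_partition P _ (arm (size h).+1)).
- apply: eq_bigr => a _; rewrite E -ht; apply: pr_draw => //.
  exact: (reward_draw run hT).
- by apply: measurableI => //; exact/measurable_hist_event/ltnW.
- by move=> a; rewrite E; apply: measurableI => //; exact: measurable_pull_event.
Qed.

Definition sample_event t (D : 'I_K -> set R) : set Omega :=
  [set x | forall b, D b (theta t b x)].

Lemma measurable_sample_event t (D : 'I_K -> set R) : (forall b, measurable (D b)) ->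
  measurable (sample_event t D).
Proof.
move=> mD; rewrite (_ : sample_event t D = \bigcap_(b in setT) (theta t b @^-1` D b)).
  by apply: fin_bigcap_measurable => // b _; exact: measurable_funPTI.
by apply/seteqP; split => [x Dx b _|x Dx b]; [exact: Dx|exact: Dx].
Qed.

Lemma pr_sample h (D : 'I_K -> set R) : (size h < T)%N -> (forall b, measurable (D b)) ->
  pr P (hist_event h `&` sample_event (size h) D) =
  prob_hist h * \prod_b beta_mass (successes h b) (failures h b) (D b).
Proof.
move=> hT mD; have mH := measurable_hist_event h (ltnW hT).
apply: EFin_inj; rewrite EFinM -prodEFin !prE//; last first.
  by apply: measurableI => //; exact: measurable_sample_event.
rewrite (theta_beta run h hT mD); congr (_ * _)%E.
by apply: eq_bigr => b _; rewrite beta_massE.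
Qed.

(* If no sample exceeds m, resampling the single arm o above m makes the algorithm pull o; by
   independence of the samples this costs the odds of the event that o stays below m. *)
Lemma pull_le h a o (m : R) (D : 'I_K -> set R) : (size h < T)%N -> a != o ->
  (forall b, measurable (D b)) ->
  (forall b, D b = `]0, 1[ `&` [set x | m < ginv b x]) ->
  0 < beta_mass (successes h o) (failures h o) (D o) ->
  prob_pull h a <= prob_hist h * beta_mass (successes h a) (failures h a) (D a) +
    beta_mass (successes h o) (failures h o) (`]0, 1[ `\` D o) /
    beta_mass (successes h o) (failures h o) (D o) * prob_pull h o.
Proof.
move=> hT ao mD DE po0.
have D01 b : D b `<=` `]0, 1[ by rewrite DE => x [].
have mI : measurable (`]0, 1[%classic : set R) by [].
have mC b : measurable (`]0, 1[ `\` D b : set R) by exact: measurableD.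
have mH := measurable_hist_event h (ltnW hT).
have mA b := measurable_arm_event (size h) b hT.
pose t := size h.
pose mass b := @beta_mass R (successes h b) (failures h b).
pose Dall b : set R := `]0, 1[%classic.
pose Da b := if b == a then D a else Dall b.
pose Dlow b : set R := `]0, 1[ `\` D b.
pose Do b := if b == o then D o else Dlow b.
have mDall b : measurable (Dall b) by [].
have mDa b : measurable (Da b) by rewrite /Da; case: eqP.
have mDlow b : measurable (Dlow b) := mC b.
have mDo b : measurable (Do b) by rewrite /Do; case: eqP => // ->.
have mev F : (forall b, measurable (F b)) -> measurable (hist_event h `&` sample_event t F).
  by move=> mF; apply: measurableI => //; exact: measurable_sample_event.
have eall : pr P (hist_event h `&` sample_event t Dall) = prob_hist h.
  by rewrite pr_sample// big1 ?mulr1// => b _; rewrite beta_mass_01.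
have ea : pr P (hist_event h `&` sample_event t Da) = prob_hist h * mass a (D a).
  rewrite pr_sample// (bigD1 a)//= /Da eqxx big1 ?mulr1// => b ba.
  by rewrite (negbTE ba) beta_mass_01.
(* [Q], the probability that all other arms stay low, is common to [Dlow] and [Do]; their ratio is
   therefore the odds for [o] alone. *)
pose Q := \prod_(b | b != o) mass b (Dlow b).
have elow : pr P (hist_event h `&` sample_event t Dlow) = prob_hist h * (mass o (Dlow o) * Q).
  by rewrite pr_sample// (bigD1 o).
have eo : pr P (hist_event h `&` sample_event t Do) = prob_hist h * (mass o (D o) * Q).
  rewrite pr_sample// (bigD1 o)//= /Do eqxx; congr (_ * (_ * _)).
  by apply: eq_bigr => b /negbTE ->.
(* A sample outside []0, 1[] belongs neither to [D b] nor to its complement there; such rounds are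
   discarded as a null event. *)
have enull : pr P (hist_event h `\` (hist_event h `&` sample_event t Dall)) = 0.
  by rewrite pr_setD ?eall ?subrr//; exact: mev.
have split_pull : prob_pull h a <=
    prob_hist h * mass a (D a) + prob_hist h * (mass o (Dlow o) * Q).
  rewrite -ea -elow -[leRHS]addr0 -enull.
  apply: le_trans (le_pr P _ ((hist_event h `&` sample_event t Da `|`
      hist_event h `&` sample_event t Dlow) `|`
      (hist_event h `\` (hist_event h `&` sample_event t Dall))) _ _ _) _.
  - exact: measurableI.
  - by apply: measurableU; [apply: measurableU; exact: mev|apply: measurableD => //; exact: mev].
  - move=> x [Hx ax]; have [I01|nI] := pselect (sample_event t Dall x); last first.
      by right; split => // -[].
    left; have [Dax|nDax] := pselect (D a (theta t a x)); [left|right]; split => // b.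
      by rewrite /Da; case: eqP => [->|_]; [exact: Dax|exact: I01].
    split; first exact: I01.
    rewrite DE => -[_ /=]; apply/negP; rewrite -leNgt.
    apply: le_trans (arm_argmax run x b hT) _; rewrite ax leNgt; apply/negP => lt.
    by apply: nDax; rewrite DE; split => //; exact: I01.
  apply: le_trans (pr_setU _ _ _ _ _) _.
  - by apply: measurableU; exact: mev.
  - by apply: measurableD => //; exact: mev.
  by rewrite lerD2r; apply: pr_setU; exact: mev.
(* If [o] alone exceeds [m], the argmax is unique, so tie-breaking is irrelevant. *)
have low_pull : prob_hist h * (mass o (D o) * Q) <= prob_pull h o.
  rewrite -eo; apply: le_pr.
  - exact: mev.
  - exact: measurableI.
  move=> x [Hx Sx]; split => //; rewrite /arm_event /=.
  apply/eqP/negPn/negP => bo; set b := arm _ x in bo.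
  have := Sx b; have := Sx o; rewrite /Do eqxx (negbTE bo) /Dlow !DE /=.
  move=> [_ /= mo] [xb nb]; apply: nb; split => //=.
  exact: lt_le_trans mo (arm_argmax run x o hT).
apply: le_trans split_pull _; rewrite lerD2l -/(mass o).
rewrite -/(mass o (`]0, 1[ `\` D o)) -/(Dlow o).
rewrite (_ : prob_hist h * _ = mass o (Dlow o) / mass o (D o) * (prob_hist h * (mass o (D o) * Q))).
  by rewrite ler_wpM2l// divr_ge0// ?beta_mass_ge0.
by field; rewrite gt_eqF.
Qed.

Lemma regretE (mu_opt : R) : regret mu_opt rew T =
  (\sum_(t < T) \sum_(h <- histories t) \sum_a (mu_opt - mu a) * prob_pull h a)%:E.
Proof.
have E t : (t < T)%N -> pr P [set x | rew t.+1 x = true] =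
    mu_opt - \sum_(h <- histories t) \sum_a (mu_opt - mu a) * prob_pull h a.
  move=> tT; rewrite pr_reward//.
  have S1 : \sum_(h <- histories t) \sum_a prob_pull h a = 1.
    rewrite -(pr_setT P) -(sum_hist_event _ t (ltnW tT) measurableT).
    rewrite big_seq [RHS]big_seq; apply: eq_bigr => h /size_histories ht.
    by rewrite sum_prob_pull ?ht// setIT.
  rewrite -[X in X - _]mulr1 -S1 mulr_sumr -sumrB; apply: eq_bigr => h _.
  by rewrite mulr_sumr -sumrB; apply: eq_bigr => a _; ring.
have mr t : measurable [set x | rew t x = true] by exact: measurable_bool_event.
have L1 t : (\1_[set x | rew t x = true] : Omega -> R) \in Lfun P 1.
  by apply/Lfun1_integrable; exact: integrable_indic.
(* Rewards are subtracted one at a time from the fixed constant [mu_opt * T]; integrability is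
   carried along for linearity of expectation. *)
suff H n : (n <= T)%N ->
    (fun w => mu_opt * T%:R - \sum_(1 <= t < n.+1) (rew t w)%:R) \in Lfun P 1 /\
    ('E_P[fun w => (mu_opt * T%:R - \sum_(1 <= t < n.+1) (rew t w)%:R)%R])%E =
    (mu_opt * T%:R - \sum_(t < n) pr P [set x | rew t.+1 x = true])%:E.
  rewrite /regret (H T (leqnn T)).2; congr EFin.
  rewrite -[T in T%:R](card_ord T) -sum1_card natr_sum mulr_sumr -sumrB.
  by apply: eq_bigr => t _; rewrite E// mulr1 opprB addrC subrK.
elim: n => [|n ih] nT.
  have -> : (fun w => mu_opt * T%:R - \sum_(1 <= t < 1) (rew t w)%:R) = cst (mu_opt * T%:R).
    by apply/funext => w; rewrite big_geq// subr0.
  by split; [exact: Lfun_cst|rewrite expectation_cst big_ord0 subr0].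
have [ih1 ih2] := ih (ltnW nT).
have -> : (fun w => mu_opt * T%:R - \sum_(1 <= t < n.+2) (rew t w)%:R) =
    (fun w => mu_opt * T%:R - \sum_(1 <= t < n.+1) (rew t w)%:R) \-
    \1_[set x | rew n.+1 x = true].
  apply/funext => w /=; rewrite big_nat_recr//= opprD addrA; congr (_ - _).
  rewrite indicE; case e : (rew n.+1 w).
    by rewrite mem_set.
  by rewrite memNset//= e.
split; first by apply: rpredB.
rewrite expectationB// ih2 expectation_indic// -prE//.
by rewrite big_ord_recr /= opprD addrA.
Qed.

End Run.

(** * Thresholds *)

Section Inverse.
Context {R : realType}.
Implicit Types (g ginv : R -> R) (x z u m : R).

Lemma strictly_monotonic01_sign g : strictly_monotonic01 g ->
  exists2 s : R, s != 0 & forall x z, 0 <= x <= 1 -> 0 <= z <= 1 -> x < z ->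
    0 < s * (g z - g x).
Proof.
move=> [gi|gd]; [exists 1|exists (-1)]; rewrite ?oppr_eq0 ?oner_eq0// => x z x01 z01 xz.
  by rewrite mul1r subr_gt0; apply: gi; rewrite ?in_itv.
by rewrite mulN1r opprB subr_gt0; apply: gd; rewrite ?in_itv.
Qed.

(** [ginv] must have the direction of [g]: otherwise comparing its values at [g 0] and [g 1] would
    give [1 <= 0]. *)
Lemma monotone_inverse01_sign g ginv (s : R) : s != 0 ->
  (forall x z, 0 <= x <= 1 -> 0 <= z <= 1 -> x < z -> 0 < s * (g z - g x)) ->
  monotone_inverse01 g ginv ->
  (forall x u, 0 <= x <= 1 -> 0 < u < 1 -> 0 <= s * (u - g x) -> x <= ginv u) /\
  (forall x u, 0 <= x <= 1 -> 0 < u < 1 -> s * (u - g x) <= 0 -> ginv u <= x).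
Proof.
move=> s0 gs [gK gmono]; set D := `]0, 1[ `|` _ in gmono.
have g01 x : 0 <= x <= 1 -> g x \in D.
  by move=> x01; rewrite inE; right; exists x; rewrite //= in_itv.
have D01 u : 0 < u < 1 -> u \in D by move=> u01; rewrite inE; left; rewrite /= in_itv.
have K x : 0 <= x <= 1 -> ginv (g x) = x by move=> x01; apply: gK; rewrite in_itv.
have g10 := gs 0 1 _ _ ltr01.
have o01 : 0 <= (0 : R) <= 1 by rewrite lexx ler01.
have l01 : 0 <= (1 : R) <= 1 by rewrite lexx ler01.
have {}g10 := g10 o01 l01.
have absurd : ~ (1 <= 0 :> R) by rewrite ler10.
case: gmono => gm; have [sn|sp|s0'] := ltgtP s 0; try by rewrite s0' eqxx in s0.
- exfalso; apply: absurd; rewrite -[leLHS](K _ l01) -[leRHS](K _ o01).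
  by apply: gm; rewrite ?g01// ltW//; move: g10; rewrite nmulr_rgt0// subr_lt0.
- split=> x u x01 u01; rewrite ?pmulr_rge0 ?pmulr_rle0// ?subr_ge0 ?subr_le0 => h.
    by rewrite -[leLHS](K _ x01); apply: gm; rewrite ?g01 ?D01.
  by rewrite -[leRHS](K _ x01); apply: gm; rewrite ?g01 ?D01.
- split=> x u x01 u01; rewrite ?nmulr_rge0 ?nmulr_rle0// ?subr_ge0 ?subr_le0 => h.
    by rewrite -[leLHS](K _ x01); apply: gm; rewrite ?g01 ?D01.
  by rewrite -[leRHS](K _ x01); apply: gm; rewrite ?g01 ?D01.
- exfalso; apply: absurd; rewrite -[leLHS](K _ l01) -[leRHS](K _ o01).
  by apply: gm; rewrite ?g01// ltW//; move: g10; rewrite pmulr_rgt0// subr_gt0.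
Qed.

(** A superlevel set of a monotone function is an interval. *)
Lemma measurable_inverse_gt g ginv m : monotone_inverse01 g ginv ->
  measurable (`]0, 1[ `&` [set x | m < ginv x] : set R).
Proof.
move=> [_ gmono]; apply: is_interval_measurable => x z.
rewrite /= !in_itv/= => -[/andP[x0 x1] mx] [/andP[z0 z1] mz] u /andP[xu uz].
have u01 : 0 < u < 1 by rewrite (lt_le_trans x0 xu) (le_lt_trans uz z1).
split; first by rewrite in_itv.
have D v : 0 < v < 1 -> v \in `]0, 1[ `|` g @` `[0, 1].
  by move=> v01; rewrite inE; left; rewrite /= in_itv.
case: gmono => gm.
  by apply: lt_le_trans mx _; apply: gm => //; apply: D => //; rewrite x0 x1.
by apply: lt_le_trans mz _; apply: gm => //; apply: D => //; rewrite z0 z1.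
Qed.

Lemma within01_left_point g (a b : R) (Q : R -> Prop) :
  {within `[0, 1], continuous g} -> 0 <= a -> a < b -> b <= 1 ->
  (\forall y \near g b, Q y) -> exists m, [/\ a < m, m < b & Q (g m)].
Proof.
move=> gc a0 ab b1 HQ.
have gl : g x @[x --> b^'-] --> g b.
  have [gi _ g1] := (continuous_within_itvP g ltr01).1 gc.
  move: b1; rewrite le_eqVlt => /orP[/eqP ->//|b1].
  apply: cvg_at_left_filter; apply: gi; rewrite in_itv/= b1 andbT.
  exact: le_lt_trans a0 ab.
near b^'- => m; exists m; split; near: m.
- exact: nbhs_left_gt.
- exact: nbhs_left_lt.
- exact: gl HQ.
Unshelve. all: by end_near. Qed.

End Inverse.

(** * Choice of the levels and assembly of the regret bound *)

Lemma suboptimal_pulls_le (R : realType) (K : nat)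
    (mu lambda : 'I_K.+1 -> R) (g : 'I_K.+1 -> R -> R) (psi : R) (a : 'I_K.+1) :
  (forall b, 0 <= mu b <= 1) -> (forall b, 0 <= lambda b <= 1) ->
  (forall b, strictly_monotonic01 (g b)) ->
  {within `[0, 1], continuous (g a)} ->
  (forall b, g b (mu b) = lambda b) ->
  0 < g a (mu ord0) < 1 -> 0 < psi -> mu a < mu ord0 ->
  exists C : R, forall (ginv : 'I_K.+1 -> R -> R) (T : nat)
      (d : measure_display) (Omega : measurableType d) (P : probability Omega R)
      (theta : nat -> 'I_K.+1 -> {RV P >-> R}) (arm : nat -> Omega -> 'I_K.+1)
      (fb rew : nat -> {RV P >-> bool}),
    (forall b, monotone_inverse01 (g b) (ginv b)) ->
    ts_cf_run mu lambda ginv T theta arm fb rew ->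
    \sum_(t < T) \sum_(h <- histories t) prob_pull P arm fb h a <=
      (1 + psi) * ln T%:R / kl_bernoulli (lambda a) (g a (mu ord0)) + C.
Proof.
move=> mu01 lam01 gmono gc gmu y01 psi0 ma; set y := g a (mu ord0).
have [sa sa0 Ha] := strictly_monotonic01_sign _ (gmono a).
have [so so0 Ho] := strictly_monotonic01_sign _ (gmono ord0).
have ya := Ha _ _ (mu01 a) (mu01 ord0) ma; rewrite gmu -/y in ya.
have ly : lambda a != y by apply: contraTneq ya => ->; rewrite subrr mulr0 ltxx.
have kl0 : 0 < kl_bernoulli (lambda a) y by exact: kl_bernoulli_gt0.
(* Dividing the divergence by [1 + psi] gives a rate strictly below it, as [beta_tail_rate] demands,
   and [ln T / e] is then the announced leading term. *)
pose e := kl_bernoulli (lambda a) y / (1 + psi).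
have psi1 : 0 < 1 + psi by rewrite addr_gt0.
have e0 : 0 < e by rewrite divr_gt0.
have ekl : e < kl_bernoulli (lambda a) y by rewrite ltr_pdivrMr// ltr_pMr// ltrDl.
have [D [C1 [bad [D0 C10 Hbad Htail]]]] := beta_tail_rate _ _ _ (lam01 a) y01 ly ekl.
have [ma0 ma1] := andP (mu01 a); have [mo0 mo1] := andP (mu01 ord0).
have [m [am mo Hm]] := within01_left_point _ _ _ _ gc ma0 ma mo1 Htail.
have m01 : 0 <= m <= 1 by rewrite (le_trans ma0 (ltW am)) (le_trans (ltW mo) mo1).
(* The inverse yields only the weak inequality [m' <= ginv ord0 x], whereas [B] asks for values
   strictly above [m]; hence a second level between [m] and [mu ord0]. *)
pose m' := (m + mu ord0) / 2.
have mm' : m < m' by rewrite /m'; lra.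
have m'o : m' < mu ord0 by rewrite /m'; lra.
have m'01 : 0 <= m' <= 1 by rewrite /m'; case/andP: m01 => ? ?; apply/andP; split; lra.
have yo := Ho _ _ m'01 (mu01 ord0) m'o; rewrite gmu in yo.
have yolam : g ord0 m' != lambda ord0.
  by apply: contraTneq yo => ->; rewrite subrr mulr0 ltxx.
have [C2 C20 Hodds] := beta_odds_summable _ _ (lam01 ord0) yolam.
exists (1 + C1 + D + C2) => ginv T d Omega P theta arm fb rew ginvP run.
pose B b : set R := `]0, 1[ `&` [set x | m < ginv b x].
have mB b : measurable (B b) := measurable_inverse_gt _ _ m (ginvP b).
have B01 b : B b `<=` `]0, 1[ by move=> x [].
have [_ upa] := monotone_inverse01_sign _ _ _ sa0 Ha (ginvP a).
have [loo _] := monotone_inverse01_sign _ _ _ so0 Ho (ginvP ord0).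
have [|po Hpo] := Hodds _ (mB ord0) (B01 ord0).
  move=> x x01 h; split; first by rewrite /= in_itv.
  apply: lt_le_trans mm' _; apply: loo => //; apply/ltW.
  rewrite -(pmulr_rgt0 _ yo) mulrACA -expr2 mulr_gt0//.
  by rewrite exprn_even_gt0.
have -> : (1 + psi) * ln T%:R / kl_bernoulli (lambda a) y = ln T%:R / e.
  by rewrite /e invf_div mulrA [_ * (1 + psi)]mulrC.
apply: (arm_pulls_le T lambda (prob_hist P arm fb) (prob_pull P arm fb) lam01 _ _ _ _ a ord0
  (fun s f => beta_mass s f (B a))
  (fun s f => beta_mass s f (`]0, 1[ `\` B ord0) / beta_mass s f (B ord0)) bad) => //.
- exact: prob_hist_nil.
- by move=> h b; exact: prob_pull_ge0.
- exact: sum_prob_pull run.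
- exact: prob_hist_rcons run.
- by move=> s f; rewrite divr_ge0 ?beta_mass_ge0.
- move=> s f; apply: Hm => // u [u01 mu_lt]; apply: (@mul_ge0_sign _ sa) => //; first exact: ltW.
  rewrite leNgt; apply/negP => h; move: mu_lt; rewrite /= ltNge => /negP; apply.
  by apply: upa => //; exact: ltW.
- move=> h hT; apply: (pull_le _ _ _ _ _ _ _ _ _ run _ _ _ m) => //.
  by apply: contraTneq ma => ->; rewrite ltxx.
Qed.

Theorem theorem3 (R : realType) (K : nat)
    (mu lambda : 'I_K.+1 -> R) (g : 'I_K.+1 -> R -> R)
    (mu01 : forall a, 0 <= mu a <= 1)
    (lambda01 : forall a, 0 <= lambda a <= 1)
    (g_mono : forall a, strictly_monotonic01 (g a))
    (g_cont : forall a, {within `[0, 1], continuous (g a)})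
    (g_mu : forall a, g a (mu a) = lambda a)
    (arm1_opt : forall a, mu a <= mu ord0)
    (kl_finite : forall a, mu a < mu ord0 -> 0 < g a (mu ord0) < 1)
    (psi : R) (psi_gt0 : 0 < psi) :
  exists C : R,
    forall (ginv : 'I_K.+1 -> R -> R) (T : nat)
      (d : measure_display) (Omega : measurableType d)
      (P : probability Omega R)
      (theta : nat -> 'I_K.+1 -> {RV P >-> R})
      (arm : nat -> Omega -> 'I_K.+1)
      (fb rew : nat -> {RV P >-> bool}),
    (forall a, monotone_inverse01 (g a) (ginv a)) ->
    ts_cf_run mu lambda ginv T theta arm fb rew ->
    (regret (mu ord0) rew T <=
       ((1 + psi) * \sum_(a < K.+1 | a != ord0)
          (mu ord0 - mu a) * ln T%:R / kl_bernoulli (lambda a) (g a (mu ord0))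
        + C)%:E)%E.
Proof.
have /choice[C HC] (a : 'I_K.+1) : exists C : R, mu a < mu ord0 ->
    forall (ginv : 'I_K.+1 -> R -> R) (T : nat)
      (d : measure_display) (Omega : measurableType d) (P : probability Omega R)
      (theta : nat -> 'I_K.+1 -> {RV P >-> R}) (arm : nat -> Omega -> 'I_K.+1)
      (fb rew : nat -> {RV P >-> bool}),
    (forall b, monotone_inverse01 (g b) (ginv b)) ->
    ts_cf_run mu lambda ginv T theta arm fb rew ->
    \sum_(t < T) \sum_(h <- histories t) prob_pull P arm fb h a <=
      (1 + psi) * ln T%:R / kl_bernoulli (lambda a) (g a (mu ord0)) + C.
  (* An arm tied with the optimum has zero gap, so any constant serves. *)
  have [ma|_] := boolP (mu a < mu ord0); last by exists 0.
  have [C HC] := suboptimal_pulls_le _ _ _ _ _ _ a mu01 lambda01 g_mono (g_cont a) g_mu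
    (kl_finite a ma) psi_gt0 ma.
  by exists C.
exists (\sum_(a < K.+1 | a != ord0) (mu ord0 - mu a) * C a).
move=> ginv T d Omega P theta arm fb rew ginvP run.
rewrite (regretE _ _ _ _ _ _ _ _ _ run) lee_fin.
under eq_bigr do rewrite exchange_big /=.
rewrite exchange_big /= (bigD1 ord0)//= big1 ?add0r; last first.
  by move=> t _; rewrite big1// => h _; rewrite subrr mul0r.
rewrite mulr_sumr -big_split /=; apply: ler_sum => a _.
under eq_bigr do rewrite -mulr_sumr.
rewrite -mulr_sumr.
have [ma|ma] := ltP (mu a) (mu ord0); last first.
  have -> : mu ord0 - mu a = 0 by apply/eqP; rewrite subr_eq0 eq_le ma arm1_opt.
  by rewrite !mul0r mulr0 addr0.
have /(ler_wpM2l (_ : 0 <= mu ord0 - mu a)) := HC a ma _ _ _ _ _ _ _ _ _ ginvP run.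
rewrite subr_ge0 ltW// => /(_ isT); lra.
Qed.
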